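(* Suppose that the coupling strength, the natural frequency density $g$ and the initial datum satisfy $$K>0,\qquad g(\omega)=\delta(\omega),\qquad \rho_0\in C^1(\mathbb T),\qquad \int_{\mathbb T}\rho_0\,d\theta=1\qquad\text{and}\qquad R_0:=R(0)>0 .$$ Let $\rho:\mathbb T\times\mathbb R_+\to\mathbb R$ be a classical solution of $$\partial_t\rho-\partial_\theta\big(KR(t)\sin(\theta-\phi(t))\,\rho\big)=0,\qquad \rho(\theta,0)=\rho_0(\theta).$$ Then the mass concentrates around the average phase $\phi(t)$ asymptotically. More precisely, for any $\delta>0$ there exists $T_1=T_1(\delta)\ge 0$ such that $$\lim_{t\to\infty}\int_{I_\delta^+(t)}\rho(\theta,t)\,d\theta=1$$ and $$\int_{I_\delta^-(t)}|\rho(\theta,t)|^2\,d\theta\le e^{-\frac{R(0)(\cos\delta)}{2}K(t-T_1)}\int_{I_\delta^-(T_1)}|\rho(\theta,T_1)|^2\,d\theta\qquad\text{for all }t\ge T_1 .$$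
   Context: $\mathbb T=\mathbb R/(2\pi\mathbb Z)$. The equation is the Kuramoto-Sakaguchi equation for identical oscillators, that is, with natural frequency density $g=\delta(\omega)$, the Dirac mass at $0$; $\rho(\cdot,t)\ge 0$ is the probability density of the phase $\theta$ at time $t$. The order parameters $R(t)\in[0,1]$ (amplitude) and $\phi(t)$ (average phase) are defined by $R(t)e^{\mathrm i\phi(t)}=\int_{\mathbb T}e^{\mathrm i\theta}\rho(\theta,t)\,d\theta$; the average phase $\phi(t)$ (modulo $2\pi$) is well defined when $R(t)>0$. For a constant $\delta>0$, $$I_\delta^+(t)=\{\theta\in\mathbb T:|\theta-\phi(t)|<\delta\},\qquad I_\delta^-(t)=\{\theta\in\mathbb T:|\theta-(\phi(t)+\pi)|<\delta\},$$ where $|\cdot|$ is the distance on the circle $\mathbb T$.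
   Formalization: The L² estimate on I_δ^-(t) is proved only for 0<δ<π; for δ≥π that set is the whole circle (up to a point) and the estimate is false, e.g. for δ=2π the left side stays ≥1/(2π) while the right side tends to 0. The limit is proved for every δ>0. *)

(* Defs.v *)
From Stdlib Require Import Reals ZArith ClassicalEpsilon.
From Coquelicot Require Import Coquelicot.
Open Scope R_scope.

(* Functions on the circle T = R / 2 pi Z are 2 pi-periodic functions on R, and
   subsets of T are 2 pi-periodic subsets of R. *)
Definition periodic (f : R -> R) : Prop := forall x, f (x + 2 * PI) = f x.

Definition C1_circle (f : R -> R) : Prop :=
  periodic f /\ forall x, ex_derive f x /\ continuous (Derive f) x.

(* The quotient distance on T. *)
Definition circle_dist (x y : R) : R :=
  real (Glb_Rbar (fun d => exists k : Z, d = Rabs (x - y - 2 * PI * IZR k))).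

Definition circle_int (f : R -> R) : R := RInt f 0 (2 * PI).

Definition circle_int_on (A : R -> Prop) (f : R -> R) : R :=
  circle_int (fun x => if excluded_middle_informative (A x) then f x else 0).

(* I_delta^+ and I_delta^- for the average phase ph. *)
Definition I_plus (delta ph : R) : R -> Prop :=
  fun theta => circle_dist theta ph < delta.
Definition I_minus (delta ph : R) : R -> Prop :=
  fun theta => circle_dist theta (ph + PI) < delta.

(* r(t) e^{i phi(t)} = int e^{i theta} rho(theta,t) dtheta with r(t) >= 0, in real
   and imaginary parts.  The bound r(t) <= 1 is a consequence when rho(.,t) is a
   probability density.  phi(t) is any representative in R of the average phase
   (arbitrary if r(t) = 0); no regularity in t is imposed on it. *)
Definition order_parameters (rho : R -> R -> R) (r phi : R -> R) : Prop :=
  forall t, 0 <= t ->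
    0 <= r t /\
    r t * cos (phi t) = circle_int (fun theta => cos theta * rho theta t) /\
    r t * sin (phi t) = circle_int (fun theta => sin theta * rho theta t).

(* rho : T x [0,oo) -> R, with arguments (theta, t); values at t < 0 are
   irrelevant.  Regularity: continuous on T x [0,oo) and C^1 on T x (0,oo), which
   in particular covers functions that are C^1 up to t = 0. *)
Definition classical_solution (K : R) (rho0 : R -> R)
    (rho : R -> R -> R) (r phi : R -> R) : Prop :=
  (forall t, 0 <= t -> periodic (fun theta => rho theta t)) /\
  continuous_on (fun p : R * R => 0 <= snd p)
    (fun p : R * R => rho (fst p) (snd p)) /\
  (forall theta t, 0 < t ->
    ex_derive (fun x => rho x t) theta /\
    ex_derive (fun s => rho theta s) t /\
    continuous (fun p : R * R => Derive (fun x => rho x (snd p)) (fst p))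
      (theta, t) /\
    continuous (fun p : R * R => Derive (fun s => rho (fst p) s) (snd p))
      (theta, t)) /\
  (forall theta t, 0 < t ->
    Derive (fun s => rho theta s) t
    - Derive (fun x => K * r t * sin (x - phi t) * rho x t) theta = 0) /\
  (forall theta, rho theta 0 = rho0 theta).

(* Main.v *)
Require Import Defs.
From Stdlib Require Import Reals ZArith ClassicalEpsilon Lra Lia.
From Coquelicot Require Import Coquelicot.
Open Scope R_scope.

(* Put [X = R cos phi], [Y = R sin phi], [V = R sin (x - phi)] and
   [U = R cos (x - phi)].  The flow gives [(R^2)' = 2 K H] with
   [H = int V^2 rho >= 0]; as [R^2] is bounded and [H] is Lipschitz, [H -> 0],
   hence [X', Y' -> 0].

   Fix [c] a little below the limit [Rinf] of [R].  The functional
   [int (c - U)_+^2 rho^2] has derivative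
   [int (c - U)_+ (K U (c - U) - 2 K V^2 - 2 U_t) rho^2], and
   [U (c - U) - 2 V^2 <= - (R^2 - c U) <= - R (c - U)], while [U_t -> 0] is
   absorbed because [R^2 - c U >= R^2 - c^2 > 0] where [U < c].  So it decays
   at any rate below [K Rinf], and with it [int rho^2] over any arc staying away
   from [phi].  Young's inequality turns this into the concentration of mass.

   For the [L^2] estimate, let [f t] be its left-hand side.  The decay rate of [f]
   exceeds [k = K R(0) cos delta / 2], so the continuous function
   [exp (k t) * f t] tends to [0] and attains its maximum over [t >= 0] at some
   [T1]; that is exactly the estimate, and no boundary terms of the moving arc
   are ever needed. *)

(** * Calculus on the line and on the circle *)

Lemma continuity_2d_pt_swap (f : R -> R -> R) (x y : R) :
  continuity_2d_pt f x y -> continuity_2d_pt (fun u v => f v u) y x.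
Proof.
  intros H eps; destruct (H eps) as [d Hd]; exists d; auto.
Qed.

Lemma continuity_2d_pt_slice (f : R -> R -> R) (x y : R) :
  continuity_2d_pt f x y -> continuity_pt (fun u => f u y) x.
Proof.
  intros H. apply continuity_pt_locally. intros eps.
  destruct (H eps) as [d Hd]; exists d; intros z Hz; apply Hd; [exact Hz|].
  rewrite Rminus_diag, Rabs_R0; apply cond_pos.
Qed.

Lemma continuity_2d_pt_of_snd (f : R -> R) (x y : R) :
  continuity_pt f y -> continuity_2d_pt (fun _ v => f v) x y.
Proof.
  intros H; apply (continuity_1d_2d_pt_comp f (fun _ v => v)); auto.
  apply continuity_2d_pt_id2.
Qed.

Lemma continuity_2d_pt_of_fst (f : R -> R) (x y : R) :
  continuity_pt f x -> continuity_2d_pt (fun u _ => f u) x y.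
Proof.
  intros H; apply (continuity_1d_2d_pt_comp f (fun u _ => u)); auto.
  apply continuity_2d_pt_id1.
Qed.

Lemma continuity_2d_pt_pow (f : R -> R -> R) (n : nat) (x y : R) :
  continuity_2d_pt f x y -> continuity_2d_pt (fun u v => f u v ^ n) x y.
Proof.
  intros H; induction n as [|n IH]; simpl.
  - apply continuity_2d_pt_const.
  - apply continuity_2d_pt_mult; assumption.
Qed.

Ltac cont2 :=
  match goal with
  | |- continuity_2d_pt (fun u v => @?f u v + @?g u v) _ _ =>
      apply (continuity_2d_pt_plus f g); cont2
  | |- continuity_2d_pt (fun u v => @?f u v - @?g u v) _ _ =>
      apply (continuity_2d_pt_minus f g); cont2
  | |- continuity_2d_pt (fun u v => @?f u v * @?g u v) _ _ =>
      apply (continuity_2d_pt_mult f g); cont2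
  | |- continuity_2d_pt (fun u v => - @?f u v) _ _ =>
      apply (continuity_2d_pt_opp f); cont2
  | |- continuity_2d_pt (fun u v => @?f u v ^ ?n) _ _ =>
      apply (continuity_2d_pt_pow f n); cont2
  | |- continuity_2d_pt (fun u v => ?c) _ _ =>
      apply (continuity_2d_pt_const _ _ c)
  | |- continuity_2d_pt (fun u v => sin u) _ _ =>
      apply (continuity_2d_pt_of_fst sin); apply continuity_sin
  | |- continuity_2d_pt (fun u v => cos u) _ _ =>
      apply (continuity_2d_pt_of_fst cos); apply continuity_cos
  | |- continuity_2d_pt (fun u v => @?f v) _ _ =>
      apply (continuity_2d_pt_of_snd f); auto
  | _ => auto
  end.

Lemma is_derive_continuity_pt (f : R -> R) (x l : R) :
  is_derive f x l -> continuity_pt f x.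
Proof.
  intros H; apply continuity_pt_filterlim.
  apply (@ex_derive_continuous R_AbsRing R_NormedModule f x); exists l; exact H.
Qed.

Ltac cont1 :=
  try assumption;
  match goal with
  | |- continuity_pt (fun u => @?f u + @?g u) _ =>
      apply (continuity_pt_plus f g); cont1
  | |- continuity_pt (fun u => @?f u - @?g u) _ =>
      apply (continuity_pt_minus f g); cont1
  | |- continuity_pt (fun u => @?f u * @?g u) _ =>
      apply (continuity_pt_mult f g); cont1
  | |- continuity_pt (fun u => - @?f u) _ =>
      apply (continuity_pt_opp f); cont1
  | |- continuity_pt (fun u => ?c) _ =>
      apply continuity_pt_const; intros ? ?; reflexivity
  | |- continuity_pt (fun u => sin u) _ => apply continuity_sin
  | |- continuity_pt (fun u => cos u) _ => apply continuity_cos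
  | _ => auto
  end.

(** * Integrals over one period *)

Lemma RInt_derive_periodic (f df : R -> R) (a b : R) :
  (forall x, is_derive f x (df x)) -> (forall x, continuity_pt df x) ->
  f a = f b -> RInt df a b = 0.
Proof.
  intros Hf Hc Hab. apply is_RInt_unique.
  replace 0 with (minus (f b) (f a)).
  - apply (@is_RInt_derive R_CompleteNormedModule); auto.
    intros x _; apply continuity_pt_filterlim; auto.
  - rewrite Hab; unfold minus, plus, opp; simpl; ring.
Qed.

Lemma ex_RInt_cont (f : R -> R) (a b : R) :
  (forall x, continuity_pt f x) -> ex_RInt f a b.
Proof.
  intros H; apply (@ex_RInt_continuous R_CompleteNormedModule).
  intros x _; apply continuity_pt_filterlim; auto.
Qed.

Lemma RInt_add (f g : R -> R) (a b : R) :
  ex_RInt f a b -> ex_RInt g a b ->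
  RInt (fun x => f x + g x) a b = RInt f a b + RInt g a b.
Proof. exact (@RInt_plus R_CompleteNormedModule f g a b). Qed.

Lemma RInt_mul_l (l : R) (f : R -> R) (a b : R) :
  ex_RInt f a b -> RInt (fun x => l * f x) a b = l * RInt f a b.
Proof. exact (@RInt_scal R_CompleteNormedModule f a b l). Qed.

Lemma RInt_shift (f : R -> R) (c a b : R) :
  ex_RInt f (a + c) (b + c) -> RInt (fun x => f (x + c)) a b = RInt f (a + c) (b + c).
Proof.
  intros H. replace (a + c) with (1 * a + c) in * by ring.
  replace (b + c) with (1 * b + c) in * by ring.
  rewrite <- (@RInt_comp_lin R_CompleteNormedModule f 1 c a b H).
  apply RInt_ext; intros x _. change (f (x + c) = 1 * f (1 * x + c)).
  now rewrite !Rmult_1_l.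
Qed.

Lemma ex_RInt_shift (f : R -> R) (c a b : R) :
  ex_RInt f (a + c) (b + c) -> ex_RInt (fun x => f (x + c)) a b.
Proof.
  intros H. replace (a + c) with (1 * a + c) in * by ring.
  replace (b + c) with (1 * b + c) in * by ring.
  apply ex_RInt_ext with (fun x => scal 1 (f (1 * x + c))).
  - intros x _. change (1 * f (1 * x + c) = f (x + c)). now rewrite !Rmult_1_l.
  - apply (@ex_RInt_comp_lin R_NormedModule); exact H.
Qed.

Lemma RInt_periodic (g : R -> R) (c : R) :
  periodic g -> (forall a b, ex_RInt g a b) ->
  RInt g c (c + 2 * PI) = RInt g 0 (2 * PI).
Proof.
  intros Hp Hi.
  rewrite <- (@RInt_Chasles R_CompleteNormedModule g c 0) by auto.
  rewrite <- (@RInt_Chasles R_CompleteNormedModule g 0 (2 * PI) (c + 2 * PI)) by auto.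
  assert (E := RInt_shift g (2 * PI) 0 c (Hi _ _)). rewrite Rplus_0_l in E.
  assert (E' : RInt (fun x => g (x + 2 * PI)) 0 c = RInt g 0 c)
    by (apply RInt_ext; intros x _; apply Hp).
  rewrite <- E, E'.
  rewrite <- (@opp_RInt_swap R_CompleteNormedModule g 0 c) by auto.
  unfold plus, opp; simpl; ring.
Qed.

(** Translates of one period cover any interval. This serves integrands cut off by an indicator:
    they are not continuous, so integrability has to be carried over from a single period. *)
Lemma ex_RInt_periodic (g : R -> R) (c : R) :
  periodic g -> ex_RInt g c (c + 2 * PI) -> forall a b, ex_RInt g a b.
Proof.
  intros Hp H.
  assert (PI_pos := PI_RGT_0).
  assert (Hp' : forall x, g (x + - (2 * PI)) = g x).
  { intros x. rewrite <- (Hp (x + _)). f_equal; ring. }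
  (* The window grows by one period on each side; its translates by [- 2 PI] and [2 PI] supply the
     two new end pieces. *)
  assert (Hn : forall n : nat, ex_RInt g (c - 2 * PI * INR n) (c + 2 * PI * INR (S n))).
  { induction n as [|n IH].
    - simpl. replace (c - _) with c by ring. now rewrite Rmult_1_r.
    - rewrite (S_INR (S n)).
      assert (A1 : ex_RInt g (c - 2 * PI * INR (S n)) (c + 2 * PI * INR n)).
      { apply ex_RInt_ext with (fun x => g (x + 2 * PI)); [intros; apply Hp|].
        apply ex_RInt_shift. rewrite S_INR in *.
        replace (_ - _ + _) with (c - 2 * PI * INR n) by ring.
        replace (_ + 2 * PI) with (c + 2 * PI * (INR n + 1)) by ring. exact IH. }
      assert (A2 : ex_RInt g (c - 2 * PI * INR n + 2 * PI) (c + 2 * PI * (INR (S n) + 1))).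
      { apply ex_RInt_ext with (fun x => g (x + - (2 * PI))); [intros; apply Hp'|].
        apply ex_RInt_shift.
        replace (_ + _) with (c - 2 * PI * INR n) by ring.
        replace (c + _ + _) with (c + 2 * PI * INR (S n)) by ring. exact IH. }
      assert (P := pos_INR n). rewrite S_INR in *.
      apply (@ex_RInt_Chasles R_NormedModule) with (c + 2 * PI * INR n); auto.
      apply (@ex_RInt_Chasles R_NormedModule) with (c + 2 * PI * (INR n + 1)).
      + apply (@ex_RInt_Chasles_2 R_CompleteNormedModule) with (c - 2 * PI * INR n);
          auto; split; nra.
      + apply (@ex_RInt_Chasles_2 R_CompleteNormedModule) with (c - 2 * PI * INR n + 2 * PI);
          auto; split; nra. }
  assert (Hw : forall a b, a <= b -> ex_RInt g a b).
  { intros a b Hab.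
    destruct (INR_unbounded (Rmax ((c - a) / (2 * PI)) ((b - c) / (2 * PI)))) as [n Hn'].
    assert (L1 := Rmax_l ((c - a) / (2 * PI)) ((b - c) / (2 * PI))).
    assert (L2 := Rmax_r ((c - a) / (2 * PI)) ((b - c) / (2 * PI))).
    assert (L3 : c - a < 2 * PI * INR n).
    { apply Rmult_lt_reg_r with (/ (2 * PI)); [apply Rinv_0_lt_compat; lra|].
      replace (2 * PI * INR n * / (2 * PI)) with (INR n) by (field; lra). unfold Rdiv in *; lra. }
    assert (L4 : b - c < 2 * PI * INR n).
    { apply Rmult_lt_reg_r with (/ (2 * PI)); [apply Rinv_0_lt_compat; lra|].
      replace (2 * PI * INR n * / (2 * PI)) with (INR n) by (field; lra). unfold Rdiv in *; lra. }
    specialize (Hn n). rewrite S_INR in Hn.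
    apply (@ex_RInt_Chasles_2 R_CompleteNormedModule) with (c - 2 * PI * INR n); [split; nra|].
    apply (@ex_RInt_Chasles_1 R_CompleteNormedModule) with (c + 2 * PI * (INR n + 1));
      [split; nra|].
    exact Hn. }
  intros a b. destruct (Rle_dec a b); auto.
  apply ex_RInt_swap, Hw; lra.
Qed.

(** Uniform continuity of [h] on a compact strip. The position [a] is a variable independent of [t]
    because the arc will follow a phase that may jump by multiples of [2 PI]. *)
Lemma continuity_2d_pt_window (h : R -> R -> R) (l r : R) : l <= r ->
  (forall x t, continuity_2d_pt h x t) ->
  forall a t, continuity_2d_pt (fun a t => RInt (fun s => h (a + s) t) l r) a t.
Proof.
  intros Hlr Hc a t eps.
  (* The [+ 1] covers the case [l = r]. The margin 1 at both ends of the strip below keeps [u + s]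
     inside it as long as [u] is within 1 of [a]. *)
  assert (He : 0 < eps / (r - l + 1)) by (apply Rdiv_lt_0_compat; [apply cond_pos | lra]).
  destruct (uniform_continuity_2d_1d h (a + l - 1) (a + r + 1) t
             (fun x _ => Hc x t) (mkposreal _ He)) as [d Hd]; simpl in Hd.
  assert (Hm : 0 < Rmin d 1) by (apply Rmin_pos; [apply cond_pos | lra]).
  exists (mkposreal _ Hm); simpl; intros u v Hu Hv.
  assert (M1 := Rmin_l d 1). assert (M2 := Rmin_r d 1).
  assert (Hi : forall u v, ex_RInt (fun s => h (u + s) v) l r).
  { intros u' v'. apply ex_RInt_cont; intros x.
    apply (continuity_pt_comp (fun s => u' + s) (fun y => h y v')).
    - cont1. apply derivable_continuous_pt, derivable_pt_id.
    - apply (continuity_2d_pt_slice h), Hc. }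
  assert (E : RInt (fun s => h (u + s) v) l r - RInt (fun s => h (a + s) t) l r
    = RInt (fun s => h (u + s) v - h (a + s) t) l r).
  { symmetry; apply (@RInt_minus R_CompleteNormedModule); auto. }
  rewrite E.
  apply Rle_lt_trans with ((r - l) * (eps / (r - l + 1))).
  - apply abs_RInt_le_const; auto.
    + apply (@ex_RInt_minus R_NormedModule); auto.
    + intros s Hs. apply Rlt_le.
      apply Rabs_def2 in Hu, Hv.
      apply Hd; try lra; try (split; lra).
      apply Rabs_def1; lra.
  - assert (P := cond_pos eps).
    replace (pos eps) with ((r - l + 1) * (eps / (r - l + 1))) at 2 by (field; lra). nra.
Qed.

(** * The circle distance and integrals over arcs *)

Lemma circle_dist_lt (x y d : R) :
  circle_dist x y < d <-> exists k : Z, Rabs (x - y - 2 * PI * IZR k) < d.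
Proof.
  unfold circle_dist.
  set (E := fun d => exists k : Z, d = Rabs (x - y - 2 * PI * IZR k)).
  destruct (Glb_Rbar_correct E) as [Hlb Hglb].
  assert (H0 : is_lb_Rbar E 0) by (intros z [k ->]; simpl; apply Rabs_pos).
  assert (Hge := Hglb 0 H0).
  assert (Hle := Hlb _ (ex_intro _ 0%Z eq_refl)).
  destruct (Glb_Rbar E) as [g| |]; simpl in *; try easy.
  split.
  (* Without such a [k], [d] would be a lower bound, hence at most the infimum. The strict
     inequality spares a proof that the infimum is attained. *)
  - intros Hg. apply Classical_Prop.NNPP; intros Hn.
    assert (Hd : is_lb_Rbar E d).
    { intros z [k ->]; simpl. apply Rnot_lt_le; intros Hk; apply Hn; eauto. }
    specialize (Hglb d Hd); simpl in Hglb; lra.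
  - intros [k Hk]. specialize (Hlb _ (ex_intro _ k eq_refl)); simpl in Hlb; lra.
Qed.

(** For [k <> 0] the translate [s - 2 PI k] has absolute value above [PI], so only [k = 0] can bring
    it below [d]. *)
Lemma circle_dist_lt_centered (a s d : R) :
  Rabs s < PI -> d <= PI -> circle_dist (a + s) a < d <-> Rabs s < d.
Proof.
  intros Hs Hd. rewrite circle_dist_lt. split.
  - intros [k Hk]. replace (a + s - a) with s in Hk by ring.
    destruct (Z.eq_dec k 0) as [->|Hk0].
    + now rewrite Rmult_0_r, Rminus_0_r in Hk.
    + assert (Pi := PI_RGT_0). exfalso.
      apply Rabs_def2 in Hk, Hs.
      destruct (Z_lt_ge_dec k 0) as [Hn|Hn].
      * assert (IZR k <= -1) by (apply IZR_le; lia). nra.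
      * assert (1 <= IZR k) by (apply IZR_le; lia). nra.
  - intros H; exists 0%Z. replace (_ - _) with s by ring. exact H.
Qed.

Lemma circle_dist_periodic (x a : R) : forall d,
  circle_dist (x + 2 * PI) a < d <-> circle_dist x a < d.
Proof.
  intros d. rewrite !circle_dist_lt. split; intros [k Hk].
  - exists (k - 1)%Z. rewrite minus_IZR.
    now replace (_ - _ - _) with (x + 2 * PI - a - 2 * PI * IZR k) by ring.
  - exists (k + 1)%Z. rewrite plus_IZR.
    now replace (_ - _ - _) with (x - a - 2 * PI * IZR k) by ring.
Qed.

(** The cut-off integrand is periodic, so the period [[0, 2 PI]] may be replaced by the one centred
    at [a], where it is [f] on a middle interval and 0 on both sides. Endpoint values do not affect
    the integrals. *)
Lemma circle_int_on_ball (f : R -> R) (a d : R) :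
  0 < d <= PI -> periodic f -> (forall x, continuity_pt f x) ->
  circle_int_on (fun x => circle_dist x a < d) f = RInt (fun s => f (a + s)) (- d) d.
Proof.
  intros [Hd0 HdP] Hp Hc. unfold circle_int_on, circle_int.
  set (g := fun x => if excluded_middle_informative (circle_dist x a < d) then f x else 0).
  assert (Pi := PI_RGT_0).
  assert (gp : periodic g).
  { intros x; unfold g.
    destruct (excluded_middle_informative _) as [H|H];
    destruct (excluded_middle_informative _) as [H'|H']; auto;
    rewrite circle_dist_periodic in H; contradiction. }
  assert (gin : forall x, Rabs (x - a) < PI -> Rabs (x - a) < d -> g x = f x).
  { intros x H1 H2; unfold g.
    destruct (excluded_middle_informative _) as [H|H]; auto.
    exfalso; apply H. replace x with (a + (x - a)) by ring.
    now apply circle_dist_lt_centered. }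
  assert (gout : forall x, Rabs (x - a) < PI -> d <= Rabs (x - a) -> g x = 0).
  { intros x H1 H2; unfold g.
    destruct (excluded_middle_informative _) as [H|H]; auto.
    replace x with (a + (x - a)) in H by ring.
    apply circle_dist_lt_centered in H; auto; lra. }
  assert (I1 : is_RInt g (a - PI) (a - d) 0).
  { apply is_RInt_ext with (fun _ => 0).
    - intros x. rewrite Rmin_left, Rmax_right by lra. intros Hx; symmetry; apply gout;
      rewrite Rabs_left by lra; lra.
    - evar_last; [apply (@is_RInt_const R_NormedModule)|].
      unfold scal; simpl; unfold mult; simpl; ring. }
  assert (I3 : is_RInt g (a + d) (a + PI) 0).
  { apply is_RInt_ext with (fun _ => 0).
    - intros x. rewrite Rmin_left, Rmax_right by lra. intros Hx; symmetry; apply gout;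
      rewrite Rabs_right by lra; lra.
    - evar_last; [apply (@is_RInt_const R_NormedModule)|].
      unfold scal; simpl; unfold mult; simpl; ring. }
  assert (I2 : is_RInt g (a - d) (a + d) (RInt f (a - d) (a + d))).
  { apply is_RInt_ext with f.
    - intros x. rewrite Rmin_left, Rmax_right by lra. intros Hx; symmetry.
      assert (Rabs (x - a) < d) by (apply Rabs_def1; lra). apply gin; lra.
    - apply (@RInt_correct R_CompleteNormedModule), ex_RInt_cont; auto. }
  assert (I := is_RInt_Chasles _ _ _ _ _ _ (is_RInt_Chasles _ _ _ _ _ _ I1 I2) I3).
  assert (Eg : RInt g (a - PI) (a + PI) = RInt f (a - d) (a + d)).
  { rewrite (is_RInt_unique _ _ _ _ I). unfold plus; simpl; ring. }
  rewrite <- (RInt_periodic g (a - PI)).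
  - replace (a - PI + 2 * PI) with (a + PI) by ring. rewrite Eg.
    replace (a - d) with (- d + a) by ring. rewrite (Rplus_comm a d).
    rewrite <- RInt_shift by (apply ex_RInt_cont; auto).
    apply RInt_ext; intros; f_equal; ring.
  - exact gp.
  - apply (ex_RInt_periodic g (a - PI) gp).
    replace (a - PI + 2 * PI) with (a + PI) by ring. eexists; exact I.
Qed.

(** * Monotonicity, limits and exponential decay *)

Lemma increasing_of_derive (f df : R -> R) (a b : R) : a <= b ->
  (forall x, a < x < b -> is_derive f x (df x)) ->
  (forall x, a <= x <= b -> continuity_pt f x) ->
  (forall x, a < x < b -> 0 <= df x) -> f a <= f b.
Proof.
  intros Hab Hd Hc Hp.
  (* The intermediate point may be an endpoint, where nothing is known about [df]; truncating by
     [Rmax 0] gives a sign there too. *)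
  destruct (MVT_gen f a b (fun x => Rmax 0 (df x))) as [c [_ E]].
  - rewrite Rmin_left, Rmax_right by lra. intros x Hx.
    rewrite Rmax_right; auto.
  - rewrite Rmin_left, Rmax_right by lra. auto.
  - assert (P := Rmax_l 0 (df c)). nra.
Qed.

Lemma bounded_monotone_limit (f : R -> R) (M : R) :
  (forall s t, 0 < s <= t -> f s <= f t) -> (forall t, 0 < t -> f t <= M) ->
  exists l, (forall t, 0 < t -> f t <= l) /\
    forall eps, 0 < eps -> exists T, 0 < T /\ forall t, T <= t -> l - eps < f t.
Proof.
  intros Hm HM.
  destruct (completeness (fun y => exists t, 0 < t /\ y = f t)) as [l [Hl1 Hl2]].
  - exists M; intros y [t [Ht ->]]; auto.
  - exists (f 1), 1; split; [lra|auto].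
  - exists l; split.
    + intros t Ht; apply Hl1; eauto.
    + intros eps He. apply Classical_Prop.NNPP; intros Hn.
      assert (l <= l - eps); [|lra].
      apply Hl2; intros y [T [HT ->]]. apply Rnot_lt_le; intros HlT.
      apply Hn; exists T; split; auto. intros t Ht.
      apply Rlt_le_trans with (f T); auto.
Qed.

(* Barbalat: if [H t >= eps], then [H >= eps / 2] on an interval of fixed
   length, along which [f] gains a fixed amount; near its supremum it cannot. *)
Lemma barbalat (f H dH : R -> R) (k L M : R) : 0 < k -> 0 < L ->
  (forall t, 0 < t -> is_derive f t (k * H t)) ->
  (forall t, 0 < t -> is_derive H t (dH t)) ->
  (forall t, 0 < t -> Rabs (dH t) <= L) ->
  (forall t, 0 < t -> 0 <= H t) ->
  (forall t, 0 < t -> f t <= M) ->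
  forall eps, 0 < eps -> exists T, 0 < T /\ forall t, T <= t -> H t < eps.
Proof.
  intros Hk HL Hf HH HdH Hpos HM eps He.
  assert (Hmono : forall s t, 0 < s <= t -> f s <= f t).
  { intros s t [Hs Hst]. apply (increasing_of_derive f (fun t => k * H t)); auto.
    - intros x Hx; apply Hf; lra.
    - intros x Hx; apply (is_derive_continuity_pt _ _ (k * H x)), Hf; lra.
    - intros x Hx. apply Rmult_le_pos; [lra|apply Hpos; lra]. }
  destruct (bounded_monotone_limit f M Hmono HM) as [l [Hl HT]].
  (* In time [h], [H] can drop by at most [L * h = eps / 2]. *)
  set (h := eps / (2 * L)).
  assert (Hh : 0 < h) by (apply Rdiv_lt_0_compat; lra).
  assert (HLh : L * h = eps / 2) by (unfold h; field; lra).
  destruct (HT (k * (eps / 2) * h)) as [T [T0 HT']];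
    [apply Rmult_lt_0_compat; [apply Rmult_lt_0_compat|]; lra|].
  exists T; split; auto. intros t Ht. apply Rnot_le_lt; intros HHt.
  destruct (MVT_gen f t (t + h) (fun t => k * H t)) as [c [Hc E]].
  - rewrite Rmin_left, Rmax_right by lra. intros x Hx; apply Hf; lra.
  - rewrite Rmin_left, Rmax_right by lra. intros x Hx.
    apply (is_derive_continuity_pt _ _ (k * H x)), Hf; lra.
  - rewrite Rmin_left, Rmax_right in Hc by lra.
    assert (Hcl : eps / 2 <= H c).
    { destruct (MVT_gen H t c dH) as [z [Hz Ez]].
      - rewrite Rmin_left, Rmax_right by lra. intros x Hx; apply HH; lra.
      - rewrite Rmin_left, Rmax_right by lra. intros x Hx.
        apply (is_derive_continuity_pt _ _ (dH x)), HH; lra.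
      - rewrite Rmin_left, Rmax_right in Hz by lra.
        assert (B := HdH z ltac:(lra)). apply Rabs_le_between in B.
        assert (- L * h <= dH z * (c - t)) by nra. lra. }
    specialize (HT' t Ht). specialize (Hl (t + h) ltac:(lra)).
    assert (eps / 2 * h <= H c * h) by (apply Rmult_le_compat_r; lra).
    replace (t + h - t) with h in E by ring.
    assert (k * (eps / 2 * h) <= k * (H c * h)) by (apply Rmult_le_compat_l; lra).
    rewrite <- Rmult_assoc in *. lra.
Qed.

Lemma exp_nondecreasing (x y : R) : x <= y -> exp x <= exp y.
Proof. intros [Hlt| ->]; [left; now apply exp_increasing | right; reflexivity]. Qed.

Lemma gronwall_decay (f df : R -> R) (k T : R) :
  (forall t, T <= t -> is_derive f t (df t)) ->
  (forall t, T <= t -> df t <= - k * f t) ->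
  forall t, T <= t -> f t <= exp (- k * (t - T)) * f T.
Proof.
  intros Hd Hle t Ht.
  assert (M : - (exp (k * (T - T)) * f T) <= - (exp (k * (t - T)) * f t)).
  { set (g := fun s => - (exp (k * (s - T)) * f s)).
    assert (Hg : forall s, T <= s ->
      is_derive g s (- (exp (k * (s - T)) * (k * f s + df s)))).
    { intros s Hs. unfold g. specialize (Hd s Hs).
      auto_derive; [eexists; exact Hd|].
      replace (Derive f s) with (df s) by (symmetry; apply is_derive_unique; exact Hd).
      change (Derive (fun x => f x) s) with (Derive f s).
      rewrite (is_derive_unique _ _ _ Hd). unfold Rminus; ring. }
    apply (increasing_of_derive g (fun s => - (exp (k * (s - T)) * (k * f s + df s)))); auto.
    - intros s Hs; apply Hg; lra.
    - intros s Hs; eapply is_derive_continuity_pt, Hg; lra.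
    - intros s Hs. specialize (Hle s ltac:(lra)). assert (E := exp_pos (k * (s - T))). nra. }
  rewrite Rminus_diag, Rmult_0_r, exp_0 in M.
  replace (- k * (t - T)) with (- (k * (t - T))) by ring. rewrite exp_Ropp.
  assert (E := exp_pos (k * (t - T))).
  apply Rmult_le_reg_l with (exp (k * (t - T))); auto.
  rewrite <- Rmult_assoc, Rinv_r by lra. lra.
Qed.

(** Squaring makes the positive part C^1, which is the regularity demanded of a transported
    weight. *)
Definition sqpos (y : R) : R := Rmax 0 y ^ 2.

Lemma is_derive_sqpos (y : R) : is_derive sqpos y (2 * Rmax 0 y).
Proof.
  apply is_derive_Reals. intros eps He.
  exists (mkposreal eps He); simpl; intros h Hh Hhe.
  (* The first-order remainder is at most [h ^ 2] whatever the signs of [y] and [y + h]; hence [eps]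
     itself serves as the radius. *)
  assert (B : Rabs (sqpos (y + h) - sqpos y - 2 * Rmax 0 y * h) <= h * h).
  { unfold sqpos, Rmax; apply Rabs_le;
    destruct (Rle_dec 0 (y + h)), (Rle_dec 0 y); split; nra. }
  replace (_ / h - _) with ((sqpos (y + h) - sqpos y - 2 * Rmax 0 y * h) / h) by (field; auto).
  unfold Rdiv. rewrite Rabs_mult, Rabs_inv.
  assert (P := Rabs_pos_lt h Hh).
  apply Rle_lt_trans with (Rabs h); auto.
  apply Rmult_le_reg_r with (Rabs h); auto.
  rewrite Rmult_assoc, Rinv_l, Rmult_1_r by lra.
  rewrite <- Rabs_mult. rewrite (Rabs_right (h * h)) by nra. exact B.
Qed.

Lemma Rmax_0_lipschitz (y z : R) : Rabs (Rmax 0 z - Rmax 0 y) <= Rabs (z - y).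
Proof.
  unfold Rmax; destruct (Rle_dec 0 z), (Rle_dec 0 y);
  apply Rabs_le; assert (A := Rabs_pos (z - y)); assert (A' := Rle_abs (z - y));
  assert (A'' := Rle_abs (- (z - y))); rewrite Rabs_Ropp in A''; lra.
Qed.

Lemma continuity_pt_Rmax_0 (y : R) : continuity_pt (Rmax 0) y.
Proof.
  apply continuity_pt_locally; intros eps; exists eps; intros z Hz.
  apply Rle_lt_trans with (Rabs (z - y)); [apply Rmax_0_lipschitz|exact Hz].
Qed.

Lemma exp_decay (C k eps : R) : 0 < k -> 0 < eps ->
  exists T, 0 <= T /\ forall t, T <= t -> C * exp (- k * t) < eps.
Proof.
  intros Hk He. assert (HC := Rabs_pos C). assert (HC' := Rle_abs C).
  (* Beyond this time [Rabs C <= k * t * eps], which is below [exp (k * t) * eps] because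
     [1 + y <= exp y]. *)
  exists (Rabs C / (k * eps)). split.
  - apply Rmult_le_pos; auto. apply Rlt_le, Rinv_0_lt_compat. nra.
  - intros t Ht.
    assert (Hkt : Rabs C <= k * t * eps).
    { apply Rmult_le_compat_r with (r := k * eps) in Ht; [|nra].
      replace (Rabs C / (k * eps) * (k * eps)) with (Rabs C) in Ht by (field; lra). lra. }
    assert (Hkt0 : 0 <= k * t) by (apply Rmult_le_reg_r with eps; lra).
    replace (- k * t) with (- (k * t)) by ring. rewrite exp_Ropp.
    assert (E := exp_ineq1_le (k * t)).
    apply Rmult_lt_reg_r with (exp (k * t)); [apply exp_pos|].
    rewrite Rmult_assoc, Rinv_l by (apply Rgt_not_eq, exp_pos). nra.
Qed.

(** If [g] is positive at some [t0], it stays below [g t0] from some [T] on, so its maximum over a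
    compact interval containing [t0] and [T] is global. Otherwise [g] vanishes for all [t >= 0] and
    [T1 = 0] serves. *)
Lemma attains_max_of_vanishing (g : R -> R) :
  (forall t, continuity_pt (fun t => g (Rmax 0 t)) t) ->
  (forall t, 0 <= t -> 0 <= g t) ->
  (forall eps, 0 < eps -> exists T, forall t, T <= t -> g t < eps) ->
  exists T1, 0 <= T1 /\ forall t, 0 <= t -> g t <= g T1.
Proof.
  intros Hc Hp Hv.
  destruct (Classical_Prop.classic (exists t0, 0 <= t0 /\ 0 < g t0)) as [[t0 [Ht0 Hg]]|Hn].
  - destruct (Hv _ Hg) as [T HT].
    assert (M1 := Rmax_l t0 T). assert (M2 := Rmax_r t0 T).
    destruct (continuity_ab_maj (fun t => g (Rmax 0 t)) 0 (Rmax t0 T)) as [T1 [HM HT1]];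
      [lra|auto|].
    assert (HM' : forall t, 0 <= t <= Rmax t0 T -> g t <= g T1).
    { intros t Ht. specialize (HM t Ht). now rewrite !Rmax_right in HM by lra. }
    exists T1; split; [lra|]. intros t Ht.
    destruct (Rle_dec t (Rmax t0 T)) as [Hle|Hnle]; [auto|].
    apply Rle_trans with (g t0); [apply Rlt_le, HT; lra|apply HM'; lra].
  - exists 0; split; [lra|]. intros t Ht. specialize (Hp 0 (Rle_refl 0)).
    apply Rle_trans with 0; auto. apply Rnot_lt_le; intros H; apply Hn; eauto.
Qed.

(** * Angles modulo [2 PI] *)

Lemma periodic_IZR (f : R -> R) (k : Z) (x : R) :
  periodic f -> f (x + 2 * PI * IZR k) = f x.
Proof.
  intros Hp.
  assert (Hn : forall (n : nat) y, f (y + 2 * PI * INR n) = f y).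
  { induction n as [|n IH]; intros y.
    - simpl; f_equal; ring.
    - rewrite S_INR. replace (y + _) with (y + 2 * PI * INR n + 2 * PI) by ring.
      rewrite Hp; apply IH. }
  destruct (Z_le_gt_dec 0 k) as [Hk|Hk].
  - rewrite <- (Z2Nat.id k Hk), <- INR_IZR_INZ. apply Hn.
  - rewrite <- (Hn (Z.to_nat (- k)) (x + _)). f_equal.
    rewrite INR_IZR_INZ, Z2Nat.id by lia. rewrite opp_IZR; ring.
Qed.

Lemma angle_representative (x : R) : exists k : Z, Rabs (x - 2 * PI * IZR k) <= PI.
Proof.
  assert (P := PI_RGT_0). destruct (archimed (x / (2 * PI) - / 2)) as [A1 A2].
  (* This rounds [x / (2 * PI)] to a nearest integer. *)
  exists (up (x / (2 * PI) - / 2)). set (k := IZR (up _)) in *.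
  assert (E : x = x / (2 * PI) * (2 * PI)) by (field; lra).
  set (y := x / (2 * PI)) in *.
  assert (B : - (1 / 2) <= y - k <= 1 / 2) by lra.
  rewrite E. replace (_ - _) with (2 * PI * (y - k)) by ring.
  apply Rabs_le; split; nra.
Qed.

(** Positivity of the cosine puts the representative of [y] in [(- PI / 2, PI / 2)], where the sine
    is increasing and its size controls the angle. *)
Lemma small_angle (y d : R) : 0 < d <= PI / 2 -> 0 < cos y -> Rabs (sin y) < sin d ->
  exists k : Z, Rabs (y - 2 * PI * IZR k) < d.
Proof.
  intros Hd Hc Hs. assert (P := PI_RGT_0).
  destruct (angle_representative y) as [k Hk]. exists k.
  assert (Ec : cos (y - 2 * PI * IZR k) = cos y).
  { assert (E := periodic_IZR cos (- k) y). rewrite opp_IZR in E.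
    replace (y - _) with (y + 2 * PI * - IZR k) by ring. apply E.
    intros x. rewrite cos_plus, cos_2PI, sin_2PI; ring. }
  assert (Es : sin (y - 2 * PI * IZR k) = sin y).
  { assert (E := periodic_IZR sin (- k) y). rewrite opp_IZR in E.
    replace (y - _) with (y + 2 * PI * - IZR k) by ring. apply E.
    intros x. rewrite sin_plus, cos_2PI, sin_2PI; ring. }
  rewrite <- Ec in Hc. rewrite <- Es in Hs. set (z := y - 2 * PI * IZR k) in *.
  apply Rnot_le_lt; intros Hz.
  assert (Hz2 : Rabs z < PI / 2).
  { apply Rnot_le_lt; intros Hz2. assert (cos (Rabs z) <= 0) by (apply cos_le_0; lra).
    unfold Rabs in H; destruct (Rcase_abs z); rewrite ?cos_neg in H; lra. }
  assert (sin d <= sin (Rabs z)) by (apply sin_incr_1; lra).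
  assert (sin (Rabs z) <= Rabs (sin z)); [|lra].
  unfold Rabs at 1; destruct (Rcase_abs z); rewrite ?sin_neg;
  [rewrite <- Rabs_Ropp|]; apply Rle_abs.
Qed.

(* [phi] itself need not be continuous: it is only determined modulo [2 PI]. *)
Lemma continuity_pt_phase (P : R -> R -> R) (r phi : R -> R) (t0 : R) :
  (forall t, periodic (fun a => P a t)) ->
  continuity_2d_pt P (phi t0) t0 ->
  0 < r t0 -> (forall t, 0 <= r t) ->
  continuity_pt (fun t => r t * cos (phi t)) t0 ->
  continuity_pt (fun t => r t * sin (phi t)) t0 ->
  continuity_pt (fun t => P (phi t) t) t0.
Proof.
  intros Hp HP Hr0 Hr Hc Hs. assert (Pi := PI_RGT_0).
  apply continuity_pt_locally; intros eps.
  destruct (HP eps) as [d Hd].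
  set (d' := Rmin d (PI / 2)).
  assert (Hd' : 0 < d' <= PI / 2).
  { split; [apply Rmin_pos; [apply cond_pos|lra]|apply Rmin_r]. }
  assert (Hsd : 0 < sin d') by (apply sin_gt_0; lra).
  (* [A] and [B] are [r cos (phi - phi t0)] and [r sin (phi - phi t0)], written as linear
     combinations of the two functions known to be continuous. *)
  set (A := fun t => r t * cos (phi t) * cos (phi t0) + r t * sin (phi t) * sin (phi t0)).
  set (B := fun t => r t * sin (phi t) * cos (phi t0) - r t * cos (phi t) * sin (phi t0)).
  assert (EA : forall t, A t = r t * cos (phi t - phi t0)).
  { intros t; unfold A. rewrite cos_minus; ring. }
  assert (EB : forall t, B t = r t * sin (phi t - phi t0)).
  { intros t; unfold B. rewrite sin_minus; ring. }
  assert (CA : continuity_pt A t0) by (unfold A; cont1).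
  assert (CB : continuity_pt B t0) by (unfold B; cont1).
  assert (EA0 : A t0 = r t0) by (rewrite EA, Rminus_diag, cos_0; ring).
  assert (EB0 : B t0 = 0) by (rewrite EB, Rminus_diag, sin_0; ring).
  (* [A] within [r t0 / 2] of [r t0] forces a positive cosine and [r t > r t0 / 2]; the bound on [B]
     can then be divided by [r t] to give a sine below [sin d']. *)
  assert (He1 : 0 < r t0 / 2) by lra.
  assert (He2 : 0 < r t0 / 2 * sin d') by nra.
  destruct (proj1 (continuity_pt_locally A t0) CA (mkposreal _ He1)) as [d1 Hd1].
  destruct (proj1 (continuity_pt_locally B t0) CB (mkposreal _ He2)) as [d2 Hd2].
  simpl in Hd1, Hd2.
  assert (Hm : 0 < Rmin d (Rmin d1 d2)) by (repeat apply Rmin_pos; apply cond_pos).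
  assert (M1 := Rmin_l d (Rmin d1 d2)). assert (M2 := Rmin_r d (Rmin d1 d2)).
  assert (M3 := Rmin_l d1 d2). assert (M4 := Rmin_r d1 d2).
  exists (mkposreal _ Hm); intros t Ht; simpl in Ht.
  assert (Ht' : Rabs (t - t0) < Rmin d (Rmin d1 d2)) by exact Ht.
  assert (HA : Rabs (A t - A t0) < r t0 / 2).
  { apply Hd1. apply Rlt_le_trans with (1 := Ht'). lra. }
  assert (HB : Rabs (B t - B t0) < r t0 / 2 * sin d').
  { apply Hd2. apply Rlt_le_trans with (1 := Ht'). lra. }
  rewrite EA0, EA in HA. rewrite EB0, EB, Rminus_0_r, Rabs_mult, (Rabs_right (r t)) in HB
    by (apply Rle_ge; auto).
  apply Rabs_def2 in HA. specialize (Hr t).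
  assert (C1 := COS_bound (phi t - phi t0)).
  assert (HcP : 0 < cos (phi t - phi t0)) by nra.
  assert (Hrt : r t0 / 2 < r t) by nra.
  assert (HsP : Rabs (sin (phi t - phi t0)) < sin d').
  { assert (Ps := Rabs_pos (sin (phi t - phi t0))). apply Rnot_le_lt; intros Hn. nra. }
  destruct (small_angle _ _ Hd' HcP HsP) as [k Hk].
  (* Periodicity of [P] replaces [phi t] by its representative close to [phi t0]. *)
  rewrite <- (periodic_IZR (fun a => P a t) (- k) (phi t) (Hp t)).
  apply Hd; [|lra].
  rewrite opp_IZR. replace (_ - _) with (phi t - phi t0 - 2 * PI * IZR k) by ring.
  apply Rlt_le_trans with (1 := Hk), Rmin_l.
Qed.

Lemma cos_le_of_arc (d s : R) : 0 < d <= PI -> d < s < 2 * PI - d -> cos s <= cos d.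
Proof.
  intros Hd Hs. destruct (Rle_dec s PI) as [H|H].
  - apply cos_decr_1; lra.
  - replace (cos s) with (cos (2 * PI - s)).
    + apply cos_decr_1; lra.
    + rewrite cos_minus, cos_2PI, sin_2PI; ring.
Qed.

(** * The flow in terms of the Cartesian order parameters *)

Section Flow.

Context (K : R) (rho rhox rhot : R -> R -> R) (X Y : R -> R).

(* In polar form [V x t = R sin (x - phi)] and [U x t = R cos (x - phi)], but
   [X] and [Y] are smooth in time whereas [phi] is only defined modulo [2 PI]. *)
Definition V (x t : R) : R := X t * sin x - Y t * cos x.
Definition U (x t : R) : R := X t * cos x + Y t * sin x.

Context
  (rho_x : forall x t, 0 < t -> is_derive (fun y => rho y t) x (rhox x t))
  (rho_t : forall x t, 0 < t -> is_derive (fun s => rho x s) t (rhot x t))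
  (rho_cont : forall x t, continuity_2d_pt (fun y s => rho y (Rmax 0 s)) x t)
  (rhox_cont : forall x t, 0 < t -> continuity_2d_pt rhox x t)
  (rhot_cont : forall x t, 0 < t -> continuity_2d_pt rhot x t)
  (rho_eq : forall x t, 0 < t ->
     rhot x t = K * (U x t * rho x t + V x t * rhox x t))
  (rho_per : forall t, 0 <= t -> periodic (fun x => rho x t))
  (rho_pos : forall x t, 0 <= t -> 0 <= rho x t)
  (mass0 : RInt (fun x => rho x 0) 0 (2 * PI) = 1)
  (X_def : forall t, 0 <= t -> X t = RInt (fun x => cos x * rho x t) 0 (2 * PI))
  (Y_def : forall t, 0 <= t -> Y t = RInt (fun x => sin x * rho x t) 0 (2 * PI)).

(* Composing with [Rmax 0] is how continuity up to [t = 0] is expressed: values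
   at negative times are meaningless. *)
Lemma rho_cont_pos (x t : R) : 0 < t -> continuity_2d_pt rho x t.
Proof.
  intros Ht; apply continuity_2d_pt_ext_loc with (fun y s => rho y (Rmax 0 s)); auto.
  exists (mkposreal t Ht); simpl; intros u v _ Hv.
  rewrite Rmax_right; auto. apply Rabs_def2 in Hv; lra.
Qed.

Lemma rho_slice (t : R) : 0 <= t -> forall x, continuity_pt (fun y => rho y t) x.
Proof.
  intros Ht x. generalize (continuity_2d_pt_slice _ x t (rho_cont x t)).
  now rewrite Rmax_right.
Qed.

(** The last clause makes the boundary terms at [0] and [2 PI] cancel when integrating by parts. *)
Definition smooth_weight (w wx wt : R -> R -> R) : Prop :=
  forall x t, 0 < t ->
    is_derive (fun y => w y t) x (wx x t) /\
    is_derive (fun s => w x s) t (wt x t) /\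
    continuity_2d_pt w x t /\ continuity_2d_pt wx x t /\ continuity_2d_pt wt x t /\
    w 0 t = w (2 * PI) t.

Lemma smooth_weight_static (psi dpsi : R -> R) :
  (forall x, is_derive psi x (dpsi x)) -> (forall x, continuity_pt dpsi x) ->
  psi 0 = psi (2 * PI) ->
  smooth_weight (fun x _ => psi x) (fun x _ => dpsi x) (fun _ _ => 0).
Proof.
  intros Hd Hc Hp x t Ht.
  split; [apply Hd|]. split; [apply (@is_derive_const R_AbsRing R_NormedModule)|].
  split; [apply continuity_2d_pt_of_fst, (is_derive_continuity_pt _ _ _ (Hd x))|].
  split; [apply continuity_2d_pt_of_fst, Hc|].
  split; [apply continuity_2d_pt_const | exact Hp].
Qed.

Lemma is_derive_V (x t : R) : is_derive (fun y => V y t) x (U x t).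
Proof. unfold V, U; auto_derive; auto; ring. Qed.

Lemma is_derive_U (x t : R) : is_derive (fun y => U y t) x (- V x t).
Proof. unfold V, U; auto_derive; auto; ring. Qed.

(** Differentiate under the integral, insert the equation and integrate by parts in [x]. The source
    contributes [n K U], the integration by parts [- K U - K V wx / w], relative to [w rho ^ n];
    written without division, this is the stated integrand. *)
Lemma transport (n : nat) (w wx wt : R -> R -> R) (t : R) :
  smooth_weight w wx wt -> 0 < t ->
  is_derive (fun s => RInt (fun x => w x s * rho x s ^ n) 0 (2 * PI)) t
    (RInt (fun x => (wt x t - K * V x t * wx x t + (INR n - 1) * K * U x t * w x t)
                    * rho x t ^ n) 0 (2 * PI)).
Proof.
  intros Hw Ht.
  set (B := fun x => (wt x t - K * V x t * wx x t + (INR n - 1) * K * U x t * w x t)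
                    * rho x t ^ n).
  (* [D] is the [x]-derivative of [K V w rho ^ n], so its integral over a period is zero; the time
     derivative of the integrand is [B + D]. *)
  set (D := fun x => K * (U x t * w x t * rho x t ^ n + V x t * wx x t * rho x t ^ n
              + V x t * w x t * (INR n * rhox x t * rho x t ^ pred n))).
  assert (Dt : forall x s, 0 < s -> is_derive (fun s => w x s * rho x s ^ n) s
     (wt x s * rho x s ^ n + w x s * (INR n * rhot x s * rho x s ^ pred n))).
  { intros x s Hs. destruct (Hw x s Hs) as (_ & H2 & _).
    apply (is_derive_mult (fun s => w x s) (fun s => rho x s ^ n)); auto.
    - apply (is_derive_pow (fun s => rho x s)); auto.
    - intros; apply Rmult_comm. }
  assert (cV : forall x, continuity_pt (fun x => V x t) x).
  { intros x; exact (is_derive_continuity_pt _ _ _ (is_derive_V x t)). }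
  assert (cU : forall x, continuity_pt (fun x => U x t) x).
  { intros x; exact (is_derive_continuity_pt _ _ _ (is_derive_U x t)). }
  assert (cw : forall x, continuity_pt (fun x => w x t) x).
  { intros x; destruct (Hw x t Ht) as (_ & _ & H & _); apply (continuity_2d_pt_slice _ x t H). }
  assert (cwx : forall x, continuity_pt (fun x => wx x t) x).
  { intros x; destruct (Hw x t Ht) as (_ & _ & _ & H & _);
    apply (continuity_2d_pt_slice _ x t H). }
  assert (cwt : forall x, continuity_pt (fun x => wt x t) x).
  { intros x; destruct (Hw x t Ht) as (_ & _ & _ & _ & H & _);
    apply (continuity_2d_pt_slice _ x t H). }
  assert (crx : forall x, continuity_pt (fun x => rhox x t) x).
  { intros x; apply (continuity_2d_pt_slice _ x t); auto. }
  assert (cp : forall m x, continuity_pt (fun x => rho x t ^ m) x).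
  { intros m x. apply (continuity_2d_pt_slice (fun x t => rho x t ^ m) x t).
    apply continuity_2d_pt_pow, rho_cont_pos; auto. }
  assert (cB : forall x, continuity_pt B x) by (intros x; unfold B; cont1).
  assert (cD : forall x, continuity_pt D x) by (intros x; unfold D; cont1).
  assert (HD : RInt D 0 (2 * PI) = 0).
  { apply (RInt_derive_periodic (fun x => K * (V x t * w x t * rho x t ^ n))); auto.
    - intros x. destruct (Hw x t Ht) as (Hx & _).
      unfold D; simpl. apply (is_derive_scal (fun x => V x t * w x t * rho x t ^ n) x K).
      replace (_ + _ + _) with
        ((U x t * w x t + V x t * wx x t) * rho x t ^ n
         + V x t * w x t * (INR n * rhox x t * rho x t ^ pred n)) by ring.
      apply (is_derive_mult (fun x => V x t * w x t) (fun x => rho x t ^ n)).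
      + apply (is_derive_mult (fun x => V x t) (fun x => w x t)); auto.
        * apply is_derive_V.
        * intros; apply Rmult_comm.
      + apply (is_derive_pow (fun x => rho x t)); auto.
      + intros; apply Rmult_comm.
    - destruct (Hw 0 t Ht) as (_ & _ & _ & _ & _ & H0). rewrite H0.
      assert (E := rho_per t (Rlt_le _ _ Ht) 0); simpl in E. rewrite Rplus_0_l in E.
      rewrite E. unfold V. rewrite sin_2PI, cos_2PI, sin_0, cos_0. ring. }
  evar_last.
  - apply (is_derive_RInt_param (fun s x => w x s * rho x s ^ n)).
    + apply (filter_imp (fun s => 0 < s)); [|now apply open_gt].
      intros s Hs x _. eexists; now apply Dt.
    + intros x _.
      apply (continuity_2d_pt_swap (fun v u => Derive (fun z => w v z * rho v z ^ n) u)).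
      apply continuity_2d_pt_ext_loc with (fun x s =>
        wt x s * rho x s ^ n + w x s * (INR n * rhot x s * rho x s ^ pred n)).
      * exists (mkposreal t Ht); simpl; intros u v _ Hv.
        symmetry; apply is_derive_unique, Dt. apply Rabs_def2 in Hv; lra.
      * destruct (Hw x t Ht) as (_ & _ & ? & ? & ? & _).
        assert (Hr := rho_cont_pos x t Ht). assert (Hrt := rhot_cont x t Ht).
        cont2.
    + apply (filter_imp (fun s => 0 < s)); [|now apply open_gt].
      intros s Hs.
      apply ex_RInt_cont; intros x.
      apply (continuity_2d_pt_slice (fun x s => w x s * rho x s ^ n) x s).
      destruct (Hw x s Hs) as (_ & _ & ? & _). assert (Hr := rho_cont_pos x s Hs).
      cont2.
  - transitivity (RInt (fun x => B x + D x) 0 (2 * PI)).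
    + apply RInt_ext; intros x _.
      etransitivity; [apply (is_derive_unique _ _ _ (Dt x t Ht))|]; rewrite (rho_eq x t Ht).
      (* [rho * rho ^ pred n = rho ^ n] fails for [n = 0], but there the factor [INR n] removes the
         term. *)
      unfold B, D; simpl. destruct n as [|m]; [simpl; ring|].
      simpl pred. rewrite S_INR. simpl pow. ring.
    + etransitivity; [apply (RInt_add B D); apply ex_RInt_cont; auto|].
      rewrite HD. apply Rplus_0_r.
Qed.

Lemma continuity_pt_integral (h : R -> R -> R) (t : R) :
  (forall x t, continuity_2d_pt h x t) ->
  continuity_pt (fun t => RInt (fun x => h x t) 0 (2 * PI)) t.
Proof.
  intros Hh. assert (P := PI_RGT_0).
  assert (C := continuity_2d_pt_window h 0 (2 * PI) ltac:(lra) Hh 0 t).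
  apply continuity_2d_pt_swap, continuity_2d_pt_slice in C.
  apply (continuity_pt_ext (fun t => RInt (fun s => h (0 + s) t) 0 (2 * PI))); auto.
  intros s; apply RInt_ext; intros; f_equal; ring.
Qed.

Lemma continuity_pt_X (t : R) : continuity_pt (fun t => X (Rmax 0 t)) t.
Proof.
  apply (continuity_pt_ext (fun t => RInt (fun x => cos x * rho x (Rmax 0 t)) 0 (2 * PI))).
  - intros s; symmetry; apply X_def, Rmax_l.
  - apply (continuity_pt_integral (fun x t => cos x * rho x (Rmax 0 t))).
    intros x s. assert (H := rho_cont x s). cont2.
Qed.

Lemma continuity_pt_Y (t : R) : continuity_pt (fun t => Y (Rmax 0 t)) t.
Proof.
  apply (continuity_pt_ext (fun t => RInt (fun x => sin x * rho x (Rmax 0 t)) 0 (2 * PI))).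
  - intros s; symmetry; apply Y_def, Rmax_l.
  - apply (continuity_pt_integral (fun x t => sin x * rho x (Rmax 0 t))).
    intros x s. assert (H := rho_cont x s). cont2.
Qed.

Lemma transport1 (w wx wt : R -> R -> R) (t : R) :
  smooth_weight w wx wt -> 0 < t ->
  is_derive (fun s => RInt (fun x => w x s * rho x s) 0 (2 * PI)) t
    (RInt (fun x => (wt x t - K * V x t * wx x t) * rho x t) 0 (2 * PI)).
Proof.
  intros Hw Ht.
  apply is_derive_ext with (fun s => RInt (fun x => w x s * rho x s ^ 1) 0 (2 * PI)).
  - intros s; apply RInt_ext; intros x _; now rewrite pow_1.
  - evar_last; [apply (transport 1 w wx wt); auto|].
    apply RInt_ext; intros x _; simpl; ring.
Qed.

(** For the constant weight 1 the transported integrand vanishes. The mean value theorem needs only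
    continuity at time 0, which [Rmax 0] provides. *)
Lemma total_mass (t : R) : 0 <= t -> RInt (fun x => rho x t) 0 (2 * PI) = 1.
Proof.
  intros Ht.
  set (m := fun t => RInt (fun x => rho x (Rmax 0 t)) 0 (2 * PI)).
  destruct (MVT_gen m 0 t (fun _ => 0)) as [c [_ E]].
  - rewrite Rmin_left, Rmax_right by lra. intros s Hs.
    apply is_derive_ext_loc with (fun s => RInt (fun x => 1 * rho x s) 0 (2 * PI)).
    + apply (filter_imp (fun u => 0 < u)); [|apply open_gt, Hs].
      intros u Hu. unfold m; rewrite Rmax_right by lra.
      apply RInt_ext; intros; apply Rmult_1_l.
    + evar_last; [apply (transport1 (fun _ _ => 1) (fun _ _ => 0) (fun _ _ => 0)); [|lra]|].
      * apply smooth_weight_static; auto.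
        -- intros x. apply (@is_derive_const R_AbsRing R_NormedModule).
        -- intros x; cont1.
      * transitivity (RInt (fun _ => 0) 0 (2 * PI)).
        -- apply RInt_ext; intros x _; simpl; ring.
        -- rewrite RInt_const. unfold scal; simpl; unfold mult; simpl; ring.
  - rewrite Rmin_left, Rmax_right by lra. intros s _.
    apply (continuity_pt_integral (fun x s => rho x (Rmax 0 s))), rho_cont.
  - unfold m in E. rewrite (Rmax_right 0 t), (Rmax_right 0 0), mass0 in E by lra. lra.
Qed.

(** An average against a probability density is bounded by a bound on the integrand. *)
Lemma RInt_rho_bound (g : R -> R) (M t : R) : 0 <= t ->
  (forall x, continuity_pt g x) -> (forall x, Rabs (g x) <= M) ->
  Rabs (RInt (fun x => g x * rho x t) 0 (2 * PI)) <= M.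
Proof.
  intros Ht Hg HM. assert (P := PI_RGT_0). assert (Cr := rho_slice t Ht).
  rewrite <- (Rmult_1_r M), <- (total_mass t Ht).
  rewrite <- RInt_mul_l by (apply ex_RInt_cont; auto).
  eapply Rle_trans; [apply abs_RInt_le; [lra|]; apply ex_RInt_cont; intros; cont1|].
  apply RInt_le; [lra| | |].
  - apply ex_RInt_cont; intros x.
    apply (continuity_pt_comp (fun x => g x * rho x t) Rabs); [cont1|apply Rcontinuity_abs].
  - apply ex_RInt_cont; intros x; cont1.
  - intros x _. rewrite Rabs_mult, (Rabs_right (rho x t)) by (apply Rle_ge; auto).
    apply Rmult_le_compat_r; auto.
Qed.

(** * Time derivatives of the order parameters *)

Definition dX (t : R) := RInt (fun x => K * sin x * V x t * rho x t) 0 (2 * PI).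
Definition dY (t : R) := RInt (fun x => - (K * cos x * V x t) * rho x t) 0 (2 * PI).
(** This is the [H] of the overview, and [order_sq] below is [R ^ 2]. *)
Definition dissipation (t : R) := RInt (fun x => V x t ^ 2 * rho x t) 0 (2 * PI).

Lemma is_derive_X (t : R) : 0 < t -> is_derive X t (dX t).
Proof.
  intros Ht.
  apply is_derive_ext_loc with (fun s => RInt (fun x => cos x * rho x s) 0 (2 * PI)).
  - apply (filter_imp (fun u => 0 < u)); [|now apply open_gt].
    intros u Hu; symmetry; apply X_def; lra.
  - evar_last.
    + apply (transport1 (fun x _ => cos x) (fun x _ => - sin x) (fun _ _ => 0)); auto.
      apply smooth_weight_static.
      * apply is_derive_cos.
      * intros x; cont1.
      * now rewrite cos_0, cos_2PI.
    + apply RInt_ext; intros x _; simpl; ring.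
Qed.

Lemma is_derive_Y (t : R) : 0 < t -> is_derive Y t (dY t).
Proof.
  intros Ht.
  apply is_derive_ext_loc with (fun s => RInt (fun x => sin x * rho x s) 0 (2 * PI)).
  - apply (filter_imp (fun u => 0 < u)); [|now apply open_gt].
    intros u Hu; symmetry; apply Y_def; lra.
  - evar_last.
    + apply (transport1 (fun x _ => sin x) (fun x _ => cos x) (fun _ _ => 0)); auto.
      apply smooth_weight_static.
      * apply is_derive_sin.
      * intros x; apply continuity_cos.
      * now rewrite sin_0, sin_2PI.
    + apply RInt_ext; intros x _; simpl; ring.
Qed.

(** Weights built from [U] and [V] have time derivatives involving [dX] and [dY], and
    [smooth_weight] asks for their continuity. *)
Lemma continuity_pt_dX (t : R) : 0 < t -> continuity_pt dX t.
Proof.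
  intros Ht.
  apply (continuity_pt_ext_loc (fun t =>
    RInt (fun x => K * sin x * V x (Rmax 0 t) * rho x (Rmax 0 t)) 0 (2 * PI))).
  - apply (filter_imp (fun u => 0 < u)); [|now apply open_gt].
    intros u Hu. now rewrite Rmax_right by lra.
  - apply (continuity_pt_integral (fun x t => K * sin x * V x (Rmax 0 t) * rho x (Rmax 0 t))).
    intros x s. assert (Cr := rho_cont x s).
    assert (CX := continuity_pt_X s). assert (CY := continuity_pt_Y s).
    unfold V; cont2.
Qed.

Lemma continuity_pt_dY (t : R) : 0 < t -> continuity_pt dY t.
Proof.
  intros Ht.
  apply (continuity_pt_ext_loc (fun t =>
    RInt (fun x => - (K * cos x * V x (Rmax 0 t)) * rho x (Rmax 0 t)) 0 (2 * PI))).
  - apply (filter_imp (fun u => 0 < u)); [|now apply open_gt].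
    intros u Hu. now rewrite Rmax_right by lra.
  - apply (continuity_pt_integral (fun x t => - (K * cos x * V x (Rmax 0 t)) * rho x (Rmax 0 t))).
    intros x s. assert (Cr := rho_cont x s).
    assert (CX := continuity_pt_X s). assert (CY := continuity_pt_Y s).
    unfold V; cont2.
Qed.

Definition order_sq (t : R) : R := X t ^ 2 + Y t ^ 2.

Lemma U_V_sqr (x t : R) : U x t ^ 2 + V x t ^ 2 = order_sq t.
Proof.
  unfold U, V, order_sq. assert (E := sin2_cos2 x); unfold Rsqr in E.
  transitivity ((X t ^ 2 + Y t ^ 2) * (sin x * sin x + cos x * cos x)); [ring|].
  rewrite E; ring.
Qed.

Lemma X_bound (t : R) : 0 <= t -> Rabs (X t) <= 1.
Proof.
  intros Ht; rewrite X_def by auto. apply RInt_rho_bound; auto.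
  - intros; apply continuity_cos.
  - intros x; apply Rabs_le, COS_bound.
Qed.

Lemma Y_bound (t : R) : 0 <= t -> Rabs (Y t) <= 1.
Proof.
  intros Ht; rewrite Y_def by auto. apply RInt_rho_bound; auto.
  - intros; apply continuity_sin.
  - intros x; apply Rabs_le, SIN_bound.
Qed.

(** The crude constant 2, from [X] and [Y] being at most 1 in size, suffices since only boundedness
    is used. *)
Lemma order_sq_bound (t : R) : 0 <= t -> order_sq t <= 2.
Proof.
  intros Ht. unfold order_sq.
  assert (BX := X_bound t Ht). assert (BY := Y_bound t Ht).
  apply Rabs_le_between in BX, BY. nra.
Qed.

Lemma V_bound (x t : R) : 0 <= t -> Rabs (V x t) <= 2.
Proof.
  intros Ht. assert (E := U_V_sqr x t). assert (B := order_sq_bound t Ht).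
  apply Rabs_le; nra.
Qed.

Lemma U_bound (x t : R) : 0 <= t -> Rabs (U x t) <= 2.
Proof.
  intros Ht. assert (E := U_V_sqr x t). assert (B := order_sq_bound t Ht).
  apply Rabs_le; nra.
Qed.

Lemma V_slice (x t : R) : continuity_pt (fun y => V y t) x.
Proof. exact (is_derive_continuity_pt _ _ _ (is_derive_V x t)). Qed.

Lemma U_slice (x t : R) : continuity_pt (fun y => U y t) x.
Proof. exact (is_derive_continuity_pt _ _ _ (is_derive_U x t)). Qed.

Context (K_pos : 0 < K).

Lemma dX_bound (t : R) : 0 <= t -> Rabs (dX t) <= 2 * K.
Proof.
  intros Ht. apply RInt_rho_bound; auto.
  - assert (C := fun x => V_slice x t). intros x; cont1.
  - intros x. rewrite !Rabs_mult, (Rabs_right K) by lra.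
    assert (B := V_bound x t Ht). assert (B' : Rabs (sin x) <= 1) by apply Rabs_le, SIN_bound.
    assert (P := Rabs_pos (V x t)). assert (P' := Rabs_pos (sin x)).
    assert (Rabs (sin x) * Rabs (V x t) <= 2) by nra. rewrite Rmult_assoc. nra.
Qed.

Lemma dY_bound (t : R) : 0 <= t -> Rabs (dY t) <= 2 * K.
Proof.
  intros Ht. apply RInt_rho_bound; auto.
  - assert (C := fun x => V_slice x t). intros x; cont1.
  - intros x. rewrite Rabs_Ropp, !Rabs_mult, (Rabs_right K) by lra.
    assert (B := V_bound x t Ht). assert (B' : Rabs (cos x) <= 1) by apply Rabs_le, COS_bound.
    assert (P := Rabs_pos (V x t)). assert (P' := Rabs_pos (cos x)).
    assert (Rabs (cos x) * Rabs (V x t) <= 2) by nra. rewrite Rmult_assoc. nra.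
Qed.

(** The sum [X dX + Y dY] has integrand [K (X sin x - Y cos x) V rho], which is [K V ^ 2 rho]. *)
Lemma is_derive_order_sq (t : R) : 0 < t -> is_derive order_sq t (2 * K * dissipation t).
Proof.
  intros Ht. assert (HX := is_derive_X t Ht). assert (HY := is_derive_Y t Ht).
  unfold order_sq. auto_derive; [split; [eexists; exact HX | split; [eexists; exact HY|auto]]|].
  change (Derive (fun x => X x) t) with (Derive X t).
  change (Derive (fun x => Y x) t) with (Derive Y t).
  rewrite (is_derive_unique _ _ _ HX), (is_derive_unique _ _ _ HY).
  assert (Cr := rho_slice t (Rlt_le _ _ Ht)). assert (CV := fun x => V_slice x t).
  transitivity (2 * (X t * dX t + Y t * dY t)); [ring|].
  unfold dX, dY. rewrite <- !RInt_mul_l, <- RInt_add by (apply ex_RInt_cont; intros; cont1).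
  rewrite Rmult_assoc. f_equal. unfold dissipation.
  rewrite <- RInt_mul_l.
  - apply RInt_ext; intros x _. unfold V at 3. unfold V; simpl; ring.
  - apply ex_RInt_cont; intros x; simpl; cont1.
Qed.

Lemma is_derive_V_t (x t : R) : 0 < t ->
  is_derive (fun s => V x s) t (dX t * sin x - dY t * cos x).
Proof.
  intros Ht. assert (HX := is_derive_X t Ht). assert (HY := is_derive_Y t Ht).
  unfold V. auto_derive; [split; [eexists; exact HX | split; [eexists; exact HY|auto]]|].
  change (Derive (fun x => X x) t) with (Derive X t).
  change (Derive (fun x => Y x) t) with (Derive Y t).
  rewrite (is_derive_unique _ _ _ HX), (is_derive_unique _ _ _ HY). ring.
Qed.

Lemma is_derive_U_t (x t : R) : 0 < t ->
  is_derive (fun s => U x s) t (dX t * cos x + dY t * sin x).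
Proof.
  intros Ht. assert (HX := is_derive_X t Ht). assert (HY := is_derive_Y t Ht).
  unfold U. auto_derive; [split; [eexists; exact HX | split; [eexists; exact HY|auto]]|].
  change (Derive (fun x => X x) t) with (Derive X t).
  change (Derive (fun x => Y x) t) with (Derive Y t).
  rewrite (is_derive_unique _ _ _ HX), (is_derive_unique _ _ _ HY). ring.
Qed.

Lemma continuity_2d_pt_V (x t : R) : 0 < t -> continuity_2d_pt V x t.
Proof.
  intros Ht. assert (CX := is_derive_continuity_pt _ _ _ (is_derive_X t Ht)).
  assert (CY := is_derive_continuity_pt _ _ _ (is_derive_Y t Ht)).
  unfold V; cont2.
Qed.

Lemma continuity_2d_pt_U (x t : R) : 0 < t -> continuity_2d_pt U x t.
Proof.
  intros Ht. assert (CX := is_derive_continuity_pt _ _ _ (is_derive_X t Ht)).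
  assert (CY := is_derive_continuity_pt _ _ _ (is_derive_Y t Ht)).
  unfold U; cont2.
Qed.

Lemma smooth_weight_V_sqr :
  smooth_weight (fun x t => V x t ^ 2) (fun x t => 2 * V x t * U x t)
    (fun x t => 2 * V x t * (dX t * sin x - dY t * cos x)).
Proof.
  intros x t Ht.
  assert (CU := continuity_2d_pt_U x t Ht). assert (CV := continuity_2d_pt_V x t Ht).
  assert (CX := continuity_pt_dX t Ht). assert (CY := continuity_pt_dY t Ht).
  split; [|split; [|split; [|split; [|split]]]]; try cont2.
  - evar_last; [apply (is_derive_pow (fun y => V y t)), is_derive_V|simpl; ring].
  - evar_last; [apply (is_derive_pow (fun s => V x s)), (is_derive_V_t x t Ht)|simpl; ring].
  - unfold V; now rewrite sin_0, cos_0, sin_2PI, cos_2PI.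
Qed.

(** * Vanishing of the dissipation *)

Lemma dissipation_nonneg (t : R) : 0 <= t -> 0 <= dissipation t.
Proof.
  intros Ht. assert (P := PI_RGT_0). apply RInt_ge_0; [lra| |].
  - assert (CV := fun x => V_slice x t). assert (Cr := rho_slice t Ht).
    apply ex_RInt_cont; intros x; simpl; cont1.
  - intros x _; apply Rmult_le_pos; [apply pow2_ge_0|apply rho_pos; lra].
Qed.

Lemma dissipation_to_0 : forall eps, 0 < eps ->
  exists T, 0 < T /\ forall t, T <= t -> dissipation t < eps.
Proof.
  (* With [U], [V] bounded by 2 and [dX], [dY] by [2 K], each of the two terms in the derivative of
     the dissipation is at most [16 K]. *)
  apply (barbalat order_sq dissipation
    (fun t => RInt (fun x => (2 * V x t * (dX t * sin x - dY t * cos x)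
                - K * V x t * (2 * V x t * U x t)) * rho x t) 0 (2 * PI))
    (2 * K) (32 * K) 2); try lra.
  - apply is_derive_order_sq.
  - intros t Ht. apply (transport1 _ _ _ t smooth_weight_V_sqr Ht).
  - intros t Ht. apply RInt_rho_bound; [lra| |].
    + assert (CV := fun x => V_slice x t). assert (CU := fun x => U_slice x t).
      intros x; cont1.
    + intros x.
      assert (BV := V_bound x t (Rlt_le _ _ Ht)). assert (BU := U_bound x t (Rlt_le _ _ Ht)).
      assert (BX := dX_bound t (Rlt_le _ _ Ht)). assert (BY := dY_bound t (Rlt_le _ _ Ht)).
      assert (Bs : Rabs (sin x) <= 1) by apply Rabs_le, SIN_bound.
      assert (Bc : Rabs (cos x) <= 1) by apply Rabs_le, COS_bound.
      assert (B1 : Rabs (dX t * sin x) <= 2 * K * 1).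
      { rewrite Rabs_mult; apply Rmult_le_compat; auto using Rabs_pos. }
      assert (B2 : Rabs (dY t * cos x) <= 2 * K * 1).
      { rewrite Rabs_mult; apply Rmult_le_compat; auto using Rabs_pos. }
      assert (B3 : Rabs (dX t * sin x - dY t * cos x) <= 4 * K).
      { eapply Rle_trans; [apply Rabs_triang|]. rewrite Rabs_Ropp; lra. }
      assert (B4 : Rabs (V x t * (dX t * sin x - dY t * cos x)) <= 2 * (4 * K)).
      { rewrite Rabs_mult; apply Rmult_le_compat; auto using Rabs_pos. }
      assert (B5 : Rabs (V x t * V x t) <= 2 * 2).
      { rewrite Rabs_mult; apply Rmult_le_compat; auto using Rabs_pos. }
      assert (B6 : Rabs (V x t * V x t * U x t) <= 2 * 2 * 2).
      { rewrite Rabs_mult; apply Rmult_le_compat; auto using Rabs_pos. }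
      apply Rabs_le_between in B4, B6. apply Rabs_le; split; nra.
  - intros t Ht; apply dissipation_nonneg; lra.
  - intros t Ht; apply order_sq_bound; lra.
Qed.

(** Young's inequality [Rabs V <= e + V ^ 2 / e], integrated against unit mass, gives
    [e + dissipation / e]. *)
Lemma RInt_V_bound (g : R -> R) (e t : R) : 0 <= t -> 0 < e ->
  (forall x, continuity_pt g x) -> (forall x, Rabs (g x) <= Rabs (V x t)) ->
  dissipation t <= e ^ 2 ->
  Rabs (RInt (fun x => g x * rho x t) 0 (2 * PI)) <= 2 * e.
Proof.
  intros Ht He Hg Hb HH. assert (P := PI_RGT_0).
  assert (CV := fun x => V_slice x t). assert (Cr := rho_slice t Ht).
  apply Rle_trans with (RInt (fun x => e * rho x t + / e * (V x t ^ 2 * rho x t)) 0 (2 * PI)).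
  - eapply Rle_trans; [apply abs_RInt_le; [lra|]; apply ex_RInt_cont; intros; cont1|].
    apply RInt_le; [lra| | |].
    + apply ex_RInt_cont; intros x.
      apply (continuity_pt_comp (fun x => g x * rho x t) Rabs); [cont1|apply Rcontinuity_abs].
    + apply ex_RInt_cont; intros x; simpl; cont1.
    + intros x _. rewrite Rabs_mult, (Rabs_right (rho x t)) by (apply Rle_ge; auto).
      assert (Hr := rho_pos x t Ht).
      assert (Rabs (g x) <= e + / e * V x t ^ 2).
      { eapply Rle_trans; [apply Hb|].
        apply Rmult_le_reg_l with e; auto.
        rewrite Rmult_plus_distr_l, <- Rmult_assoc, Rinv_r, Rmult_1_l by lra.
        rewrite <- (pow2_abs (V x t)). nra. }
      nra.
  - rewrite RInt_add, !RInt_mul_l, total_mass by (auto; apply ex_RInt_cont; intros; simpl; cont1).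
    fold (dissipation t).
    assert (/ e * dissipation t <= e); [|lra].
    apply Rmult_le_reg_l with e; auto. rewrite <- Rmult_assoc, Rinv_r by lra. lra.
Qed.

Lemma dX_dY_to_0 : forall eps, 0 < eps ->
  exists T, 0 < T /\ forall t, T <= t -> Rabs (dX t) <= eps /\ Rabs (dY t) <= eps.
Proof.
  intros eps He. set (e := eps / (2 * K)).
  assert (e_pos : 0 < e) by (apply Rdiv_lt_0_compat; lra).
  assert (Ee : K * (2 * e) = eps) by (unfold e; field; lra).
  destruct (dissipation_to_0 (e ^ 2)) as [T [HT HTe]]; [nra|].
  exists T; split; auto. intros t Ht.
  assert (CV := fun x => V_slice x t). assert (Cr := rho_slice t ltac:(lra)).
  rewrite <- Ee, <- (Rabs_right K) by lra. specialize (HTe t Ht).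
  split.
  - replace (dX t) with (K * RInt (fun x => sin x * V x t * rho x t) 0 (2 * PI)).
    + rewrite Rabs_mult. apply Rmult_le_compat_l; [apply Rabs_pos|].
      apply RInt_V_bound; try lra; [intros; cont1|].
      intros x. rewrite Rabs_mult. assert (B : Rabs (sin x) <= 1) by apply Rabs_le, SIN_bound.
      assert (P := Rabs_pos (V x t)). nra.
    + rewrite <- RInt_mul_l by (apply ex_RInt_cont; intros; cont1).
      apply RInt_ext; intros x _; simpl; ring.
  - replace (dY t) with (K * RInt (fun x => - (cos x * V x t) * rho x t) 0 (2 * PI)).
    + rewrite Rabs_mult. apply Rmult_le_compat_l; [apply Rabs_pos|].
      apply RInt_V_bound; try lra; [intros; cont1|].
      intros x. rewrite Rabs_Ropp, Rabs_mult.
      assert (B : Rabs (cos x) <= 1) by apply Rabs_le, COS_bound.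
      assert (P := Rabs_pos (V x t)). nra.
    + rewrite <- RInt_mul_l by (apply ex_RInt_cont; intros; cont1).
      apply RInt_ext; intros x _; simpl; ring.
Qed.

(** Time 0 is included, through [Rmax 0], so that later values can be compared with [R(0)]. *)
Lemma order_sq_increasing (s t : R) : 0 <= s <= t -> order_sq s <= order_sq t.
Proof.
  intros Hst.
  replace (order_sq s) with (order_sq (Rmax 0 s)) by (now rewrite Rmax_right by lra).
  replace (order_sq t) with (order_sq (Rmax 0 t)) by (now rewrite Rmax_right by lra).
  apply (increasing_of_derive (fun t => order_sq (Rmax 0 t)) (fun t => 2 * K * dissipation t)); [lra| | |].
  - intros x Hx. apply is_derive_ext_loc with order_sq.
    + apply (filter_imp (fun u => 0 < u)); [|apply open_gt; lra].
      intros u Hu. now rewrite Rmax_right by lra.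
    + apply is_derive_order_sq; lra.
  - intros x _. assert (CX := continuity_pt_X x). assert (CY := continuity_pt_Y x).
    unfold order_sq; simpl; cont1.
  - intros x Hx. assert (B := dissipation_nonneg x ltac:(lra)). nra.
Qed.

(** * Decay away from the average phase *)

Definition lyapunov (c t : R) : R := RInt (fun x => sqpos (c - U x t) * rho x t ^ 2) 0 (2 * PI).

Lemma smooth_weight_sqpos (c : R) :
  smooth_weight (fun x t => sqpos (c - U x t)) (fun x t => 2 * Rmax 0 (c - U x t) * V x t)
    (fun x t => - (2 * Rmax 0 (c - U x t) * (dX t * cos x + dY t * sin x))).
Proof.
  intros x t Ht.
  assert (CU := continuity_2d_pt_U x t Ht). assert (CV := continuity_2d_pt_V x t Ht).
  assert (CX := continuity_pt_dX t Ht). assert (CY := continuity_pt_dY t Ht).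
  assert (CM : continuity_2d_pt (fun x t => Rmax 0 (c - U x t)) x t).
  { apply (continuity_1d_2d_pt_comp (Rmax 0) (fun x t => c - U x t));
      [apply continuity_pt_Rmax_0|].
    cont2. }
  split; [|split; [|split; [|split; [|split]]]].
  - evar_last; [apply (is_derive_comp sqpos (fun y => c - U y t))|].
    + apply is_derive_sqpos.
    + apply (is_derive_minus (fun _ => c));
        [apply (@is_derive_const R_AbsRing R_NormedModule)|apply is_derive_U].
    + unfold scal, minus, plus, opp, zero; simpl; unfold mult; simpl; ring.
  - evar_last; [apply (is_derive_comp sqpos (fun s => c - U x s))|].
    + apply is_derive_sqpos.
    + apply (is_derive_minus (fun _ => c));
        [apply (@is_derive_const R_AbsRing R_NormedModule)|apply (is_derive_U_t x t Ht)].
    + unfold scal, minus, plus, opp, zero; simpl; unfold mult; simpl; ring.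
  - apply (continuity_1d_2d_pt_comp sqpos (fun x t => c - U x t)); [|cont2].
    exact (is_derive_continuity_pt _ _ _ (is_derive_sqpos _)).
  - cont2.
  - cont2.
  - unfold U; now rewrite sin_0, cos_0, sin_2PI, cos_2PI.
Qed.

(** Here [m] is a lower bound for [R] and [q = c - U]. Where [q > 0], the factor multiplying [q] is
    at most [- K (R ^ 2 - c U)] plus the [U_t] term. A quarter of this dissipation absorbs the [U_t]
    term, of size at most [4 e]; the other three quarters give the rate [3/4 K m]. *)
Lemma lyapunov_integrand_le (c m e x t : R) : 0 <= t -> 0 < c < m ->
  Rabs (dX t) <= e -> Rabs (dY t) <= e -> 16 * e <= K * (m ^ 2 - c ^ 2) ->
  m ^ 2 <= order_sq t ->
  - (2 * Rmax 0 (c - U x t) * (dX t * cos x + dY t * sin x))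
    - K * V x t * (2 * Rmax 0 (c - U x t) * V x t) + (INR 2 - 1) * K * U x t * sqpos (c - U x t)
  <= - (3 / 4 * K * m) * sqpos (c - U x t).
Proof.
  intros Ht Hc BX BY He Hm.
  assert (E := U_V_sqr x t).
  assert (Bs : Rabs (sin x) <= 1) by apply Rabs_le, SIN_bound.
  assert (Bc : Rabs (cos x) <= 1) by apply Rabs_le, COS_bound.
  assert (B1 : Rabs (dX t * cos x) <= e * 1).
  { rewrite Rabs_mult; apply Rmult_le_compat; auto using Rabs_pos. }
  assert (B2 : Rabs (dY t * sin x) <= e * 1).
  { rewrite Rabs_mult; apply Rmult_le_compat; auto using Rabs_pos. }
  apply Rabs_le_between in B1, B2.
  set (d := dX t * cos x + dY t * sin x). assert (Bd : - (2 * e) <= d) by (unfold d; lra).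
  unfold sqpos. simpl INR. replace (1 + 1 - 1) with 1 by ring.
  destruct (Rle_dec (c - U x t) 0) as [Hq|Hq].
  - rewrite Rmax_left by auto. lra.
  - rewrite Rmax_right by lra. set (q := c - U x t) in *.
    set (u := U x t) in *. set (v := V x t) in *.
    (* For [u >= - m] this follows from [(m - c) (m + u) >= 0]; for [u < - m], from [u ^ 2 <= R ^ 2]
       and [(u + m) (u - c) >= 0]. *)
    assert (A1 : m * q <= m ^ 2 - u * c + (order_sq t - m ^ 2)).
    { unfold q. destruct (Rle_dec (- m) u) as [Hu|Hu]; nra. }
    assert (A2 : m ^ 2 - c ^ 2 <= order_sq t - u * c) by (unfold q in Hq; nra).
    assert (A3 : K * u * q - 2 * K * v ^ 2 - 2 * d <= - (3 / 4 * K * m) * q).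
    { assert (K * (3 / 4 * m * q + 1 / 4 * (m ^ 2 - c ^ 2)) <= K * (order_sq t - u * c))
        by (apply Rmult_le_compat_l; lra).
      assert (K * (u * q - 2 * v ^ 2) <= K * (u * c - order_sq t)).
      { apply Rmult_le_compat_l; [lra|]. unfold q. nra. }
      nra. }
    assert (q * (K * u * q - 2 * K * v ^ 2 - 2 * d) <= q * (- (3 / 4 * K * m) * q))
      by (apply Rmult_le_compat_l; lra).
    nra.
Qed.

(** Transport with [n = 2], followed by Gronwall. The bound [m ^ 2 <= R ^ 2] is asked at [T] only,
    since [R ^ 2] increases. *)
Lemma lyapunov_decay (c m e T : R) : 0 < T -> 0 < c < m ->
  (forall t, T <= t -> Rabs (dX t) <= e /\ Rabs (dY t) <= e) ->
  16 * e <= K * (m ^ 2 - c ^ 2) -> m ^ 2 <= order_sq T ->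
  forall t, T <= t -> lyapunov c t <= exp (- (3 / 4 * K * m) * (t - T)) * lyapunov c T.
Proof.
  intros HT Hc Hd He Hm. assert (P := PI_RGT_0).
  apply (gronwall_decay (lyapunov c) (fun t =>
    RInt (fun x => (- (2 * Rmax 0 (c - U x t) * (dX t * cos x + dY t * sin x))
    - K * V x t * (2 * Rmax 0 (c - U x t) * V x t) + (INR 2 - 1) * K * U x t * sqpos (c - U x t))
    * rho x t ^ 2) 0 (2 * PI))).
  - intros t Ht. apply (transport 2 _ _ _ t (smooth_weight_sqpos c)). lra.
  - intros t Ht. assert (Ht0 : 0 < t) by lra.
    assert (CV := fun x => V_slice x t). assert (CU := fun x => U_slice x t).
    assert (Cr := rho_slice t (Rlt_le _ _ Ht0)).
    assert (CM : forall x, continuity_pt (fun x => Rmax 0 (c - U x t)) x).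
    { intros x. apply (continuity_pt_comp (fun x => c - U x t) (Rmax 0));
        [cont1|apply continuity_pt_Rmax_0]. }
    assert (CS : forall x, continuity_pt (fun x => sqpos (c - U x t)) x).
    { intros x. apply (continuity_pt_comp (fun x => c - U x t) sqpos); [cont1|].
      exact (is_derive_continuity_pt _ _ _ (is_derive_sqpos _)). }
    unfold lyapunov. rewrite <- RInt_mul_l by (apply ex_RInt_cont; intros; simpl; cont1).
    apply RInt_le; [lra| | |].
    + apply ex_RInt_cont; intros; simpl; cont1.
    + apply ex_RInt_cont; intros; simpl; cont1.
    + intros x _. rewrite <- (Rmult_assoc (- (3 / 4 * K * m))).
      apply Rmult_le_compat_r; [apply pow2_ge_0|].
      destruct (Hd t Ht). apply lyapunov_integrand_le with e; auto; try lra.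
      apply Rle_trans with (order_sq T); auto. apply order_sq_increasing; lra.
Qed.

(* With [Rinf] the limit of [R], take [c = (1 + gamma) / 2 * Rinf], so that the
   weight is bounded below where [U <= gamma R], and a lower bound
   [m = (3 + gamma) / 4 * Rinf > c] of [R] for large times.  As [m >= 3/4 Rinf],
   the rate [3/4 K m] is at least [9/16 K R(0)]: what matters is that it exceeds
   [1/2 K R(0)]. *)
Lemma arc_decay (gamma : R) : 0 < order_sq 0 -> 0 <= gamma < 1 ->
  exists C T, 0 < T /\ forall t, T <= t -> forall l r, l <= r <= l + 2 * PI ->
    (forall x, l < x < r -> U x t <= gamma * sqrt (order_sq t)) ->
    RInt (fun x => rho x t ^ 2) l r <= C * exp (- (9 / 16 * K * sqrt (order_sq 0)) * t).
Proof.
  intros H0 Hg. assert (P := PI_RGT_0).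
  destruct (bounded_monotone_limit order_sq 2) as [L [HL1 HL2]].
  { intros s t Hst; apply order_sq_increasing; lra. }
  { intros t Ht; apply order_sq_bound; lra. }
  assert (H0L : order_sq 0 <= L).
  { apply Rle_trans with (order_sq 1); [apply order_sq_increasing; lra|apply HL1; lra]. }
  set (q := sqrt L).
  assert (q2 : q ^ 2 = L) by (apply pow2_sqrt; lra).
  assert (q0 : sqrt (order_sq 0) <= q) by (apply sqrt_le_1; lra).
  assert (s0 : 0 < sqrt (order_sq 0)) by (apply sqrt_lt_R0; auto).
  set (c := (1 + gamma) / 2 * q). set (m := (3 + gamma) / 4 * q).
  assert (Hc : 0 < c) by (unfold c; nra).
  assert (Hcm : c < m) by (unfold c, m; nra).
  assert (Hmq : m < q) by (unfold m; nra).
  assert (Hm34 : 3 / 4 * q <= m) by (unfold m; nra).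
  destruct (HL2 (L - m ^ 2)) as [T1 [HT1 HT1']]; [nra|].
  assert (He : 0 < K * (m ^ 2 - c ^ 2) / 16).
  { apply Rdiv_lt_0_compat; [apply Rmult_lt_0_compat; nra|lra]. }
  destruct (dX_dY_to_0 _ He) as [T2 [HT2 HT2']].
  set (T := Rmax T1 T2).
  assert (M1 := Rmax_l T1 T2 : T1 <= T). assert (M2 := Rmax_r T1 T2 : T2 <= T).
  assert (D := lyapunov_decay c m _ T ltac:(lra) (conj Hc Hcm)
    (fun t Ht => HT2' t (Rle_trans _ _ _ M2 Ht)) ltac:(lra)).
  specialize (HT1' T M1). specialize (D ltac:(lra)).
  (* [g = c - gamma * q] bounds [c - U] from below on the arc. *)
  set (g := (1 - gamma) / 2 * q). assert (g_pos : 0 < g) by (unfold g; nra).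
  exists (/ g ^ 2 * (exp (3 / 4 * K * m * T) * lyapunov c T)), T.
  split; [lra|]. intros t Ht l r Hlr HU. assert (Ht0 : 0 <= t) by lra.
  assert (CU := fun x => U_slice x t). assert (Cr := rho_slice t Ht0).
  assert (CS : forall x, continuity_pt (fun x => sqpos (c - U x t)) x).
  { intros x. apply (continuity_pt_comp (fun x => c - U x t) sqpos); [cont1|].
    exact (is_derive_continuity_pt _ _ _ (is_derive_sqpos _)). }
  set (F := fun x => sqpos (c - U x t) * rho x t ^ 2).
  assert (Fi : forall a b, ex_RInt F a b).
  { intros; apply ex_RInt_cont; intros; unfold F; simpl; cont1. }
  assert (Fpos : forall x, 0 <= F x).
  { intros x; apply Rmult_le_pos; apply pow2_ge_0. }
  (* The arc lies within one period and [F] is nonnegative. *)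
  assert (I1 : RInt F l r <= lyapunov c t).
  { replace (lyapunov c t) with (RInt F l (l + 2 * PI)).
    - rewrite <- (@RInt_Chasles R_CompleteNormedModule F l r (l + 2 * PI)) by auto.
      assert (0 <= RInt F r (l + 2 * PI)) by (apply RInt_ge_0; auto; lra).
      unfold plus; simpl; lra.
    - apply RInt_periodic; auto. intros x. unfold F.
      rewrite (rho_per t Ht0 x). unfold U. rewrite sin_plus, cos_plus, sin_2PI, cos_2PI.
      now rewrite !Rmult_1_r, !Rmult_0_r, Rplus_0_r, Rminus_0_r. }
  assert (I2 : g ^ 2 * RInt (fun x => rho x t ^ 2) l r <= RInt F l r).
  { rewrite <- RInt_mul_l by (apply ex_RInt_cont; intros; simpl; cont1).
    apply RInt_le; auto; [lra|apply ex_RInt_cont; intros; simpl; cont1|].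
    intros x Hx. apply Rmult_le_compat_r; [apply pow2_ge_0|].
    unfold sqpos. apply pow_incr; split; [lra|].
    assert (sqrt (order_sq t) <= q) by (apply sqrt_le_1_alt, HL1; lra).
    assert (gamma * sqrt (order_sq t) <= gamma * q) by (apply Rmult_le_compat_l; lra).
    specialize (HU x Hx). eapply Rle_trans; [|apply Rmax_r]. unfold g, c. lra. }
  assert (I3 := D t Ht).
  assert (lyapunov_pos : 0 <= lyapunov c T).
  { assert (CU' := fun x => U_slice x T). assert (Cr' := rho_slice T ltac:(lra)).
    apply RInt_ge_0; [lra| |intros x _; apply Rmult_le_pos; apply pow2_ge_0].
    apply ex_RInt_cont; intros x. apply (continuity_pt_mult (fun x => sqpos (c - U x T))).
    - apply (continuity_pt_comp (fun x => c - U x T) sqpos); [cont1|].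
      exact (is_derive_continuity_pt _ _ _ (is_derive_sqpos _)).
    - simpl; cont1. }
  replace (- (3 / 4 * K * m) * (t - T))
    with (3 / 4 * K * m * T + - (3 / 4 * K * m) * t) in I3 by ring.
  rewrite exp_plus in I3.
  assert (I4 : exp (- (3 / 4 * K * m) * t) <= exp (- (9 / 16 * K * sqrt (order_sq 0)) * t)).
  { assert (K * (9 / 16 * sqrt (order_sq 0)) <= K * (3 / 4 * m)) by (apply Rmult_le_compat_l; lra).
    apply exp_nondecreasing. apply Rmult_le_compat_r; lra. }
  assert (E1 := exp_pos (3 / 4 * K * m * T)).
  assert (0 < g ^ 2) by (apply pow_lt; auto).
  apply Rmult_le_reg_l with (g ^ 2); auto.
  rewrite <- !Rmult_assoc, Rinv_r, Rmult_1_l by lra.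
  eapply Rle_trans; [exact I2|]. eapply Rle_trans; [exact I1|]. eapply Rle_trans; [exact I3|].
  rewrite (Rmult_assoc (exp _)), (Rmult_comm _ (lyapunov c T)), <- Rmult_assoc.
  apply Rmult_le_compat_l; auto. apply Rmult_le_pos; lra.
Qed.

End Flow.

(** * Concentration for the polar order parameters *)

(** [Rmax 0] is 1-Lipschitz with values in the closed half-line, so the same radius works. *)
Lemma continuity_2d_pt_of_continuous_on (f : R -> R -> R) (x t : R) :
  continuous_on (fun p : R * R => 0 <= snd p) (fun p : R * R => f (fst p) (snd p)) ->
  continuity_2d_pt (fun y s => f y (Rmax 0 s)) x t.
Proof.
  intros Hf eps.
  specialize (Hf (x, Rmax 0 t) (Rmax_l 0 t)).
  destruct (proj1 (filterlim_locally _ _) Hf eps) as [d Hd].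
  exists d; intros u v Hu Hv.
  apply (Hd (u, Rmax 0 v)); [|apply Rmax_l].
  split; simpl; [exact Hu|].
  apply Rle_lt_trans with (2 := Hv), Rmax_0_lipschitz.
Qed.

Lemma solution_properties (K : R) (rho0 : R -> R) (rho : R -> R -> R) (r phi : R -> R) :
  0 < K -> circle_int rho0 = 1 ->
  (forall theta t, 0 <= t -> 0 <= rho theta t) ->
  order_parameters rho r phi -> 0 < r 0 ->
  classical_solution K rho0 rho r phi ->
  (forall x t, continuity_2d_pt (fun y s => rho y (Rmax 0 s)) x t) /\
  (forall t, 0 <= t -> RInt (fun x => rho x t) 0 (2 * PI) = 1) /\
  (forall t, 0 <= t -> r 0 <= r t) /\
  (forall t, continuity_pt (fun t => r (Rmax 0 t) * cos (phi (Rmax 0 t))) t) /\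
  (forall t, continuity_pt (fun t => r (Rmax 0 t) * sin (phi (Rmax 0 t))) t) /\
  (forall d, 0 < d <= PI -> exists C T, 0 < T /\ forall t, T <= t ->
     RInt (fun x => rho x t ^ 2) (phi t + d) (phi t + 2 * PI - d)
     <= C * exp (- (9 / 16 * K * r 0) * t)).
Proof.
  intros HK Hmass Hpos Hop Hr0 [Hper [Hcont [Hreg [Heq Hinit]]]].
  set (X := fun t => r t * cos (phi t)). set (Y := fun t => r t * sin (phi t)).
  set (rhox := fun x t => Derive (fun y => rho y t) x).
  set (rhot := fun x t => Derive (fun s => rho x s) t).
  assert (rho_x : forall x t, 0 < t -> is_derive (fun y => rho y t) x (rhox x t)).
  { intros x t Ht. apply Derive_correct. now destruct (Hreg x t Ht). }
  assert (rho_t : forall x t, 0 < t -> is_derive (fun s => rho x s) t (rhot x t)).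
  { intros x t Ht. apply Derive_correct. now destruct (Hreg x t Ht) as (_ & ? & _). }
  assert (rho_cont : forall x t, continuity_2d_pt (fun y s => rho y (Rmax 0 s)) x t).
  { intros x t. now apply continuity_2d_pt_of_continuous_on. }
  assert (rhox_cont : forall x t, 0 < t -> continuity_2d_pt rhox x t).
  { intros x t Ht. apply continuity_2d_pt_filterlim.
    now destruct (Hreg x t Ht) as (_ & _ & ? & _). }
  assert (rhot_cont : forall x t, 0 < t -> continuity_2d_pt rhot x t).
  { intros x t Ht. apply continuity_2d_pt_filterlim.
    now destruct (Hreg x t Ht) as (_ & _ & _ & ?). }
  assert (EU : forall x t, U X Y x t = r t * cos (x - phi t)).
  { intros x t; unfold U, X, Y. rewrite cos_minus; ring. }
  assert (EV : forall x t, V X Y x t = r t * sin (x - phi t)).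
  { intros x t; unfold V, X, Y. rewrite sin_minus; ring. }
  assert (rho_eq : forall x t, 0 < t ->
     rhot x t = K * (U X Y x t * rho x t + V X Y x t * rhox x t)).
  { intros x t Ht. specialize (Heq x t Ht). specialize (rho_x x t Ht).
    rewrite EU, EV.
    assert (D : is_derive (fun x => K * r t * sin (x - phi t) * rho x t) x
      (K * (r t * cos (x - phi t) * rho x t + r t * sin (x - phi t) * rhox x t))).
    { auto_derive; [eexists; exact rho_x|].
      change (Derive (fun y => rho y t) x) with (rhox x t).
      unfold Rminus; ring. }
    apply Rminus_diag_uniq in Heq. unfold rhot. rewrite Heq.
    exact (is_derive_unique _ _ _ D). }
  assert (mass0 : RInt (fun x => rho x 0) 0 (2 * PI) = 1).
  { rewrite <- Hmass. apply RInt_ext; intros x _; apply Hinit. }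
  assert (X_def : forall t, 0 <= t -> X t = RInt (fun x => cos x * rho x t) 0 (2 * PI)).
  { intros t Ht. apply (Hop t Ht). }
  assert (Y_def : forall t, 0 <= t -> Y t = RInt (fun x => sin x * rho x t) 0 (2 * PI)).
  { intros t Ht. apply (Hop t Ht). }
  assert (Eord : forall t, order_sq X Y t = r t ^ 2).
  { intros t; unfold order_sq, X, Y. assert (E := sin2_cos2 (phi t)); unfold Rsqr in E.
    transitivity (r t ^ 2 * (sin (phi t) * sin (phi t) + cos (phi t) * cos (phi t))); [ring|].
    rewrite E; ring. }
  assert (Esqrt : forall t, 0 <= t -> sqrt (order_sq X Y t) = r t).
  { intros t Ht. rewrite Eord. apply sqrt_pow2, (Hop t Ht). }
  split; [exact rho_cont|].
  split; [exact (total_mass K rho rhox rhot X Y rho_x rho_t rho_cont rhox_cont rhot_cont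
    rho_eq Hper mass0)|].
  split.
  { intros t Ht. rewrite <- (Esqrt 0), <- (Esqrt t) by lra. apply sqrt_le_1_alt.
    apply (order_sq_increasing K rho rhox rhot X Y); auto. lra. }
  split; [exact (continuity_pt_X rho X rho_cont X_def)|].
  split; [exact (continuity_pt_Y rho Y rho_cont Y_def)|].
  intros d Hd.
  assert (Hcd : cos d < 1) by (rewrite <- cos_0; apply cos_decreasing_1; lra).
  (* Since [arc_decay] asks for [gamma >= 0], [cos d] is truncated at 0 to allow obtuse [d]. *)
  destruct (arc_decay K rho rhox rhot X Y rho_x rho_t rho_cont rhox_cont rhot_cont rho_eq
    Hper Hpos mass0 X_def Y_def HK (Rmax 0 (cos d))) as [C [T [HT HC]]].
  - rewrite Eord. apply pow_lt; auto.
  - split; [apply Rmax_l|apply Rmax_lub_lt; lra].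
  - exists C, T; split; auto. intros t Ht. rewrite (Esqrt 0) in HC by lra.
    apply HC; auto; [lra|]. intros x Hx.
    rewrite EU, Esqrt by lra. rewrite Rmult_comm.
    apply Rmult_le_compat_r; [apply (Hop t); lra|].
    apply Rle_trans with (cos d); [apply cos_le_of_arc; lra|apply Rmax_r].
Qed.

(** Turns concentration near the phase into smallness on the complementary arc, where the decay is
    known. *)
Lemma circle_int_on_ball_compl (f : R -> R) (a d : R) :
  0 < d <= PI -> periodic f -> (forall x, continuity_pt f x) ->
  circle_int_on (fun x => circle_dist x a < d) f
  = RInt f 0 (2 * PI) - RInt f (a + d) (a + 2 * PI - d).
Proof.
  intros Hd Hp Hc. rewrite circle_int_on_ball by auto.
  assert (Hi : forall l r, ex_RInt f l r) by (intros; apply ex_RInt_cont; auto).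
  rewrite <- (RInt_periodic f (a - d) Hp Hi).
  assert (E1 : RInt f (a - d) (a + d) + RInt f (a + d) (a - d + 2 * PI)
    = RInt f (a - d) (a - d + 2 * PI)) by (apply (@RInt_Chasles R_CompleteNormedModule); auto).
  rewrite <- E1. replace (a - d + 2 * PI) with (a + 2 * PI - d) by ring.
  assert (E2 := RInt_shift f a (- d) d (Hi _ _)).
  replace (- d + a) with (a - d) in E2 by ring. rewrite (Rplus_comm d a) in E2.
  assert (E3 : RInt (fun s => f (a + s)) (- d) d = RInt (fun s => f (s + a)) (- d) d)
    by (apply RInt_ext; intros; now rewrite Rplus_comm).
  rewrite E3, E2. symmetry. apply Rplus_minus_r.
Qed.

(** Young's inequality [f <= lam + f ^ 2 / lam], which passes from the [L^2] decay to mass. *)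
Lemma RInt_le_sqr (f : R -> R) (l r lam : R) : l <= r -> 0 < lam ->
  (forall x, continuity_pt f x) ->
  RInt f l r <= (r - l) * lam + / lam * RInt (fun x => f x ^ 2) l r.
Proof.
  intros Hlr Hl Hc.
  replace ((r - l) * lam) with (RInt (fun _ => lam) l r)
    by (rewrite RInt_const; reflexivity).
  rewrite <- RInt_mul_l, <- RInt_add by (apply ex_RInt_cont; intros; simpl; cont1).
  apply RInt_le; auto; try (apply ex_RInt_cont; intros; simpl; cont1).
  intros x _. apply Rmult_le_reg_l with lam; auto.
  rewrite Rmult_plus_distr_l, <- (Rmult_assoc lam (/ lam)), Rinv_r by lra. nra.
Qed.

(* The L^2 estimate is asserted for delta < PI only: for delta >= PI the set
   I_delta^- is all of T, or T minus a point, and the estimate is false (if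
   cos delta > 0 it would make the L^2 norm on T of a probability density tend
   to 0). *)
Theorem theorem3p1
  (K : R) (rho0 : R -> R) (rho : R -> R -> R) (r phi : R -> R)
  (hK : 0 < K)
  (hrho0 : C1_circle rho0)
  (hmass : circle_int rho0 = 1)
  (hnonneg : forall theta t, 0 <= t -> 0 <= rho theta t)
  (hop : order_parameters rho r phi)
  (hR0 : 0 < r 0)
  (hsol : classical_solution K rho0 rho r phi) :
  forall delta, 0 < delta ->
  exists T1, 0 <= T1 /\
    is_lim (fun t => circle_int_on (I_plus delta (phi t))
                       (fun theta => rho theta t)) p_infty 1 /\
    (delta < PI ->
     forall t, T1 <= t ->
       circle_int_on (I_minus delta (phi t))
         (fun theta => (Rabs (rho theta t)) ^ 2)
       <= exp (- (r 0 * cos delta / 2) * K * (t - T1)) *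
          circle_int_on (I_minus delta (phi T1))
            (fun theta => (Rabs (rho theta T1)) ^ 2)).
Proof.
  intros d Hd. assert (Pi := PI_RGT_0).
  destruct (solution_properties K rho0 rho r phi hK hmass hnonneg hop hR0 hsol)
    as (Hcont & Hmass & Hr & Hcos & Hsin & Hdecay).
  assert (Hper : forall t, 0 <= t -> periodic (fun x => rho x t)) by apply hsol.
  assert (Hslice : forall t, 0 <= t -> forall x, continuity_pt (fun x => rho x t) x).
  { intros t Ht x. assert (E := continuity_2d_pt_slice _ x t (Hcont x t)).
    cbv beta in E. now rewrite Rmax_right in E. }
  assert (Hlim : is_lim (fun t => circle_int_on (I_plus d (phi t)) (fun x => rho x t)) p_infty 1).
  { apply is_lim_spec; intros eps. simpl.
    destruct (Rle_dec d PI) as [HdP|HdP].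
    - destruct (Hdecay d (conj Hd HdP)) as [C [T [HT HC]]].
      (* An arc of length at most [2 PI] then contributes at most [eps / 2], leaving [eps / 2] for
         the square term. *)
      set (lam := eps / (4 * PI)).
      assert (Hlam : 0 < lam) by (apply Rdiv_lt_0_compat; [apply cond_pos|lra]).
      assert (Elam : 2 * PI * lam = eps / 2) by (unfold lam; field; lra).
      assert (He := cond_pos eps).
      destruct (exp_decay C (9 / 16 * K * r 0) (lam * (eps / 2))) as [T' [HT' HC']]; [nra|nra|].
      exists (Rmax T T'). intros t Ht.
      assert (M1 := Rmax_l T T'). assert (M2 := Rmax_r T T').
      assert (Ht0 : 0 <= t) by lra.
      unfold I_plus. rewrite circle_int_on_ball_compl by auto.
      rewrite Hmass by auto. set (m := RInt _ (phi t + d) _).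
      assert (Hm0 : 0 <= m).
      { apply RInt_ge_0; [lra|apply ex_RInt_cont; auto|intros; auto]. }
      assert (Hm : m <= (phi t + 2 * PI - d - (phi t + d)) * lam
        + / lam * RInt (fun x => rho x t ^ 2) (phi t + d) (phi t + 2 * PI - d)).
      { apply RInt_le_sqr; auto; lra. }
      assert (Hq : / lam *
        RInt (fun x => rho x t ^ 2) (phi t + d) (phi t + 2 * PI - d) < eps / 2).
      { apply Rmult_lt_reg_l with lam; auto. rewrite <- Rmult_assoc, Rinv_r, Rmult_1_l by lra.
        apply Rle_lt_trans with (1 := HC t ltac:(lra)). apply HC'; lra. }
      apply Rabs_def1; nra.
    (* For [d > PI] the ball is the whole circle. *)
    - exists 0; intros t Ht. unfold circle_int_on, circle_int.
      rewrite (RInt_ext _ (fun x => rho x t)).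
      + rewrite Hmass by lra. rewrite Rminus_diag, Rabs_R0. apply cond_pos.
      + intros x _. destruct (excluded_middle_informative _) as [H|H]; auto.
        exfalso; apply H, circle_dist_lt.
        destruct (angle_representative (x - phi t)) as [k Hk]. exists k. lra. }
  destruct (Rlt_dec d PI) as [HdP|HdP]; [|exists 0; split; [lra|split; [exact Hlim|lra]]].
  (* The arc integral with its centre [a] freed from [phi t]: [P] is jointly continuous, and
     periodic in [a]. *)
  set (P := fun a t => RInt (fun s => rho (a + s) (Rmax 0 t) ^ 2) (PI - d) (PI + d)).
  assert (HP : forall t, 0 <= t ->
    circle_int_on (I_minus d (phi t)) (fun x => Rabs (rho x t) ^ 2) = P (phi t) t).
  { intros t Ht. unfold P. rewrite Rmax_right by auto.
    assert (Hp2 : periodic (fun x => Rabs (rho x t) ^ 2)).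
    { intros x. now rewrite (Hper t Ht x). }
    assert (Hc2 : forall x, continuity_pt (fun x => Rabs (rho x t) ^ 2) x).
    { intros x. apply continuity_pt_ext with (fun x => rho x t ^ 2).
      - intros y; now rewrite pow2_abs.
      - specialize (Hslice t Ht x). simpl; cont1. }
    unfold I_minus. rewrite circle_int_on_ball by (auto; lra).
    assert (E := RInt_shift (fun s => Rabs (rho (phi t + s) t) ^ 2) PI (- d) d).
    replace (- d + PI) with (PI - d) in E by ring. rewrite (Rplus_comm d PI) in E.
    transitivity (RInt (fun s => Rabs (rho (phi t + s) t) ^ 2) (PI - d) (PI + d)).
    - rewrite <- E.
      + apply RInt_ext; intros s _. do 3 f_equal; ring.
      + apply ex_RInt_cont; intros s.
        apply (continuity_pt_comp (fun s => phi t + s) (fun x => Rabs (rho x t) ^ 2)); auto.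
        cont1. apply derivable_continuous_pt, derivable_pt_id.
    - apply RInt_ext; intros s _. apply pow2_abs. }
  (* The arc of radius [d] about [phi + PI] is the complement of the arc of radius [PI - d] about
     [phi], up to endpoints. *)
  assert (HPbound : forall t, 0 <= t ->
    P (phi t) t = RInt (fun x => rho x t ^ 2) (phi t + (PI - d)) (phi t + 2 * PI - (PI - d))).
  { intros t Ht. unfold P. rewrite Rmax_right by auto.
    assert (E := RInt_shift (fun x => rho x t ^ 2) (phi t) (PI - d) (PI + d)).
    replace (phi t + (PI - d)) with (PI - d + phi t) by ring.
    replace (phi t + 2 * PI - (PI - d)) with (PI + d + phi t) by ring.
    rewrite <- E.
    - apply RInt_ext; intros s _. now rewrite Rplus_comm.
    - apply ex_RInt_cont; intros x. specialize (Hslice t Ht x). simpl; cont1. }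
  set (k := r 0 * cos d / 2 * K).
  set (g := fun t => exp (k * t) * P (phi t) t).
  destruct (attains_max_of_vanishing g) as [T1 [HT1 Hmax]].
  - intros t. unfold g.
    apply (continuity_pt_ext (fun t => exp (k * Rmax 0 t) * P (phi (Rmax 0 t)) t)).
    { intros s. f_equal. unfold P. now rewrite (Rmax_right 0 (Rmax 0 s)) by apply Rmax_l. }
    apply (continuity_pt_mult (fun t => exp (k * Rmax 0 t))).
    + apply (continuity_pt_comp (fun t => k * Rmax 0 t) exp).
      * assert (C := continuity_pt_Rmax_0 t).
        apply (continuity_pt_mult (fun _ => k) (Rmax 0)); cont1.
      * apply derivable_continuous_pt, derivable_pt_exp.
    + apply (continuity_pt_phase P (fun t => r (Rmax 0 t)) (fun t => phi (Rmax 0 t))); auto.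
      * intros s a. unfold P. apply RInt_ext; intros x _.
        replace (a + 2 * PI + x) with (a + x + 2 * PI) by ring.
        now rewrite (Hper (Rmax 0 s) (Rmax_l _ _) (a + x)).
      * apply (continuity_2d_pt_window (fun x s => rho x (Rmax 0 s) ^ 2)); [lra|].
        intros x s. apply (continuity_2d_pt_pow (fun x s => rho x (Rmax 0 s))); auto.
      * apply Rlt_le_trans with (r 0); auto. apply Hr, Rmax_l.
      * intros s. apply (hop (Rmax 0 s)), Rmax_l.
  - intros t Ht. apply Rmult_le_pos; [apply Rlt_le, exp_pos|].
    rewrite HPbound by auto. apply RInt_ge_0; [lra| |intros; apply pow2_ge_0].
    apply ex_RInt_cont; intros x. specialize (Hslice t Ht x). simpl; cont1.
  - intros eps He. destruct (Hdecay (PI - d) ltac:(lra)) as [C [T [HT HC]]].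
    (* [1/16 = 9/16 - 1/2] is the surplus of the decay rate over [K * r 0 / 2], which is at least
       [k] because [cos d <= 1]. *)
    destruct (exp_decay C (1 / 16 * K * r 0) eps) as [T' [HT' HC']]; [nra|auto|].
    exists (Rmax T T'). intros t Ht.
    assert (M1 := Rmax_l T T'). assert (M2 := Rmax_r T T').
    specialize (HC t ltac:(lra)). specialize (HC' t ltac:(lra)).
    assert (HP0 : 0 <= P (phi t) t).
    { rewrite HPbound by lra. apply RInt_ge_0; [lra| |intros; apply pow2_ge_0].
      apply ex_RInt_cont; intros x. specialize (Hslice t ltac:(lra) x). simpl; cont1. }
    rewrite <- HPbound in HC by lra.
    apply Rle_lt_trans with (2 := HC'). unfold g.
    apply Rle_trans with (exp (1 / 2 * K * r 0 * t) * P (phi t) t).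
    + apply Rmult_le_compat_r; auto. apply exp_nondecreasing. apply Rmult_le_compat_r; [lra|].
      assert (B := COS_bound d). unfold k.
      assert (r 0 * K * cos d <= r 0 * K * 1) by (apply Rmult_le_compat_l; nra). nra.
    + apply Rle_trans with (exp (1 / 2 * K * r 0 * t) * (C * exp (- (9 / 16 * K * r 0) * t))).
      * apply Rmult_le_compat_l; auto. apply Rlt_le, exp_pos.
      * rewrite <- Rmult_assoc, (Rmult_comm _ C), Rmult_assoc, <- exp_plus.
        right. do 2 f_equal. field.
  (* Maximality of [g] at [T1], divided by [exp (k * t)], is the estimate. *)
  - exists T1. split; [exact HT1|]. split; [exact Hlim|]. intros _ t Ht.
    rewrite !HP by lra. specialize (Hmax t ltac:(lra)). unfold g in Hmax.
    replace (- (r 0 * cos d / 2) * K * (t - T1)) with (k * T1 + - (k * t)) by (unfold k; ring).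
    rewrite exp_plus, exp_Ropp.
    assert (E := exp_pos (k * t)).
    apply Rmult_le_reg_l with (exp (k * t)); auto.
    replace (exp (k * t) * (exp (k * T1) * / exp (k * t) * P (phi T1) T1))
      with (exp (k * T1) * P (phi T1) T1) by (field; lra).
    exact Hmax.
Qed.
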